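(* Let $\gamma>-1$ and $\delta\in\mathbb{R}$, and for integers $n\ge0$ let $$\mathcal{R}_n^{(\gamma,\delta)}(x)=(-i)^nJ_n^{(\gamma+i\delta,\gamma-i\delta)}(ix)$$ be the Romanovski polynomials. Then the polynomials $\mathcal{R}_n^{(\gamma,\delta)}(x)$ are orthogonal on the interval $(-i,i)$ of the imaginary axis, with weight function, up to a multiplicative constant, $$\omega(x)=(1-ix)^{\gamma+i\delta}(1+ix)^{\gamma-i\delta}=(x^2+1)^\gamma e^{2\delta\arctan(x)},$$ and the orthogonality relation reads $$\int_{-i}^{i}\mathcal{R}_m^{(\gamma,\delta)}(x)\mathcal{R}_n^{(\gamma,\delta)}(x)(x^2+1)^\gamma e^{2\delta\arctan(x)}\,dx=\frac{2^{2\gamma+1}}{2n+2\gamma+1}\,\frac{\Gamma(n+1+\gamma+i\delta)\Gamma(n+1+\gamma-i\delta)}{\Gamma(n+1+2\gamma)\Gamma(n+1)}\,\delta_{m,n}.$$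
   Context: $J_n^{(\alpha,\beta)}(x)=\sum_{k=0}^n\binom{n+\alpha}{n-k}\binom{n+\beta}{k}\left(\frac{x-1}{2}\right)^k\left(\frac{x+1}{2}\right)^{n-k}$ denotes the Jacobi polynomial in its standard normalization, with complex parameters $\alpha,\beta$ allowed. $\Gamma$ is the Gamma function, $\delta_{m,n}$ is the Kronecker symbol (distinct from the real parameter $\delta$), and $m,n\ge0$ are integers. The integral is along the segment $(-i,i)$ of the imaginary axis, and the powers and $\arctan$ are the principal branches there.
   Formalization: The right-hand side of the orthogonality relation carries an added factor i(-1)^n, since as printed it fails (γ=δ=0, m=n=0 gives 2i, not 2); at n=0, γ=-1/2, where the printed value is undefined, the limit value is used. *)

(* Defs.v *)
From Stdlib Require Import Arith Reals.
From Coquelicot Require Export Coquelicot.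
Open Scope R_scope.

Definition Cexp (z : C) : C :=
  (exp (Re z) * cos (Im z), exp (Re z) * sin (Im z)).

(* The principal argument, with values in (-PI, PI]; the value at 0 carries
   no meaning. *)
Definition Carg (z : C) : R :=
  if Rle_dec 0 (Im z) then acos (Re z / Cmod z) else - acos (Re z / Cmod z).

(* The principal branches of log, z^a and arctan.  The values of [Clog] and
   [Cpower] at z = 0 carry no meaning. *)
Definition Clog (z : C) : C := (ln (Cmod z), Carg z).

Definition Cpower (z a : C) : C := Cexp (a * Clog z)%C.

Definition Catan (z : C) : C :=
  ((Clog (1 + Ci * z) - Clog (1 - Ci * z)) / (2 * Ci))%C.

Fixpoint Cprod (f : nat -> C) (n : nat) : C :=
  match n with
  | O => RtoC 1
  | S k => (Cprod f k * f k)%C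
  end.

(* a (a - 1) ... (a - k + 1) / k! *)
Definition Cbinom (a : C) (k : nat) : C :=
  (Cprod (fun j => a - INR j)%C k / INR (fact k))%C.

(* Euler's integral, convergent for Re z > 0. *)
Definition Gamma_integral (z : C) : C :=
  RInt_gen (V := C_R_CompleteNormedModule)
    (fun t : R => (Cpower t (z - 1) * exp (- t))%C)
    (at_right 0) (Rbar_locally p_infty).

(* The least N such that Re z + N > 0. *)
Definition Gamma_shift (z : C) : nat := Z.to_nat (up (- Re z)).

(* Continuation to C minus {0, -1, -2, ...} by Gamma (z + 1) = z Gamma z:
     Gamma z = Gamma (z + N) / (z (z + 1) ... (z + N - 1)).
   The values at the poles 0, -1, -2, ... carry no meaning. *)
Definition Gamma (z : C) : C :=
  let N := Gamma_shift z in
  (Gamma_integral (z + INR N) / Cprod (fun k => z + INR k)%C N)%C.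

Definition jacobi (a b : C) (n : nat) (x : C) : C :=
  sum_n (fun k : nat =>
    Cbinom (INR n + a) (n - k) * Cbinom (INR n + b) k
    * ((x - 1) / 2) ^ k * ((x + 1) / 2) ^ (n - k))%C n.

Definition romanovski (g d : R) (n : nat) (x : C) : C :=
  ((- Ci) ^ n * jacobi (g + Ci * d) (g - Ci * d) n (Ci * x))%C.

Definition romanovski_weight (g d : R) (x : C) : C :=
  (Cpower (1 - Ci * x) (g + Ci * d) * Cpower (1 + Ci * x) (g - Ci * d))%C.

(* The integral of f dz along the segment from a to b converges, as an
   improper integral at both ends, and its value is l. *)
Definition is_segment_integral (f : C -> C) (a b l : C) : Prop :=
  is_RInt_gen (V := C_R_NormedModule)
    (fun s : R => (f (a + s * (b - a)) * (b - a))%C)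
    (at_right 0) (at_left 1) l.

Definition orthogonal_on_segment (p : nat -> C -> C) (w : C -> C) (a b : C)
  : Prop :=
  forall m n : nat, m <> n ->
    is_segment_integral (fun x => p m x * p n x * w x)%C a b 0.

Definition kronecker (m n : nat) : C := if Nat.eq_dec m n then 1%C else 0%C.

(* Main.v *)
Require Import Defs.
From Stdlib Require Import Reals Lra Lia ZArith.
From Coquelicot Require Import Coquelicot.
Open Scope R_scope.

(** On the segment x = i (2 s - 1), 0 < s < 1, the Jacobi polynomial is
    evaluated at 1 - 2 s and the weight is 2^(2g) s^(a-1) (1-s)^(b-1) with
    a = g + 1 + i d and b = g + 1 - i d, so every integral is a combination of
    Beta integrals.  In the basis s^k (1-s)^(n-k) the product of two Jacobi
    polynomials is homogeneous of degree m + n, hence all these Beta integrals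
    have the same denominator Gamma(a + b + m + n), and for m <= n the inner sum
    becomes an n-th finite difference of a polynomial of degree m: it vanishes
    for m < n, and for m = n what remains is a Vandermonde sum.

    The identity B(a, b) Gamma(a + b) = Gamma(a) Gamma(b) needs no double
    integral: writing B(a, b) as the integral of t^(a-1) (1+t)^(-a-b) over
    (0, oo), N^a B(a, b + N) tends to Gamma(a), because (1 + t/N)^(-N) tends to
    exp(-t) with an error O((t + t^2) / N) relative to a fixed integrable
    function; and integration by parts gives an exact relation between
    B(a, b + 1 + N), B(b, 1 + N) and B(a + b, 1 + N). *)

(** * Complex exponentials and improper integrals *)

(** The finite difference arises because the binomial n + a - 1 over n - k, multiplied by the
    Pochhammer symbol (a)_k, is (a)_n / (n - k)!, and likewise for b: once the Beta integrals are
    written with Gamma, only (-1)^k / (k! (n - k)!) times a polynomial in k of degree l + (m - l) =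
    m remains. For -1 < g < 0 the weight is unbounded at both ends. The convergence of the Beta and
    Gamma integrals and the error in the limit N -> oo all rest on one family of majorants with an
    elementary primitive. The half-line form of Beta is convenient twice: a dilation t -> t / N
    leads to Gamma, and the derivative of t^a (1 + t)^(-p) is a combination of two kernels of the
    same shape. Since a + b = 2 g + 2 is real and positive, nonvanishing of Gamma has to be proved
    only at positive reals, where the integrand is positive. The argument of Gamma (n + 1 + 2 g) in
    the final formula may lie in (-1, 0), hence the functional equation is proved for Re z > -1. *)

Lemma Cexp_0 : Cexp 0 = 1%C.
Proof.
unfold Cexp; simpl; rewrite exp_0, cos_0, sin_0; unfold RtoC.
apply injective_projections; simpl; ring.
Qed.

Lemma Cexp_plus (x y : C) : Cexp (x + y) = (Cexp x * Cexp y)%C.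
Proof.
destruct x as [a b], y as [c e]; unfold Cexp; simpl.
rewrite exp_plus, cos_plus, sin_plus.
apply injective_projections; simpl; ring.
Qed.

Lemma Cmod_Cexp (z : C) : Cmod (Cexp z) = exp (Re z).
Proof.
destruct z as [a b]; unfold Cmod, Cexp; simpl.
replace (_ + _) with (Rsqr (exp a) * (Rsqr (sin b) + Rsqr (cos b)))
  by (unfold Rsqr; ring).
rewrite sin2_cos2, Rmult_1_r, sqrt_Rsqr; [reflexivity|].
apply Rlt_le, exp_pos.
Qed.

Lemma Cexp_RtoC (x : R) : Cexp x = RtoC (exp x).
Proof.
unfold Cexp; simpl; rewrite cos_0, sin_0.
apply injective_projections; simpl; ring.
Qed.

Lemma Clog_pos (t : R) : 0 < t -> Clog t = RtoC (ln t).
Proof.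
intros Ht; unfold Clog, Carg; rewrite Cmod_R, Rabs_pos_eq by lra; simpl.
destruct (Rle_dec 0 0) as [_|n]; [|lra].
replace (t / t) with 1 by (field; lra).
rewrite acos_1; reflexivity.
Qed.

Lemma Cpower_pos (t : R) (z : C) : 0 < t -> Cpower t z = Cexp (z * ln t).
Proof. now intros Ht; unfold Cpower; rewrite Clog_pos. Qed.

Lemma Cpower_plus (t : R) (z w : C) :
  0 < t -> Cpower t (z + w) = (Cpower t z * Cpower t w)%C.
Proof.
intros Ht; rewrite !Cpower_pos, <- Cexp_plus by easy; f_equal; ring.
Qed.

Lemma Cpower_mult_base (s t : R) (z : C) :
  0 < s -> 0 < t -> Cpower (s * t)%R z = (Cpower s z * Cpower t z)%C.
Proof.
intros Hs Ht; rewrite !Cpower_pos, <- Cexp_plus, ln_mult, RtoC_plus;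
  try easy; [f_equal; ring|].
now apply Rmult_lt_0_compat.
Qed.

Lemma Cpower_INR (t : R) (n : nat) :
  0 < t -> Cpower t (INR n) = (RtoC t ^ n)%C.
Proof.
intros Ht; rewrite Cpower_pos by easy.
rewrite <- RtoC_mult, Cexp_RtoC, <- RtoC_pow; f_equal.
now rewrite <- Rpower_pow.
Qed.

Lemma Cpower_R (t x : R) : 0 < t -> Cpower t x = RtoC (Rpower t x).
Proof.
intros Ht; rewrite Cpower_pos, <- RtoC_mult by easy; apply Cexp_RtoC.
Qed.

Lemma is_derive_C (u v : R -> R) (t du dv : R) :
  is_derive u t du -> is_derive v t dv ->
  is_derive (V := C_R_NormedModule) (fun t => (u t, v t)) t (du, dv).
Proof.
intros Hu Hv.
apply (is_derive_ext (V := C_R_NormedModule)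
  (fun t => plus (scal (u t) ((1, 0) : C_R_NormedModule))
                 (scal (v t) ((0, 1) : C_R_NormedModule)))).
{ intros s; unfold plus, scal; simpl.
  unfold prod_plus, prod_scal, plus, scal; simpl; unfold mult; simpl.
  apply injective_projections; simpl; ring. }
replace ((du, dv) : C) with
  (plus (scal du ((1, 0) : C_R_NormedModule))
        (scal dv ((0, 1) : C_R_NormedModule))).
2:{ unfold plus, scal; simpl.
  unfold prod_plus, prod_scal, plus, scal; simpl; unfold mult; simpl.
  apply injective_projections; simpl; ring. }
apply @is_derive_plus; apply @is_derive_scal_l; assumption.
Qed.

(** Both kernels below are exponentials of a complex combination of two real functions, ln t with ln
    (1 + s t) or ln t with t; this form serves them all. *)
Lemma is_derive_Cexp (a b : C) (u v : R -> R) (t du dv : R) :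
  is_derive u t du -> is_derive v t dv ->
  is_derive (V := C_R_NormedModule) (fun t => Cexp (a * u t + b * v t)) t
    ((a * du + b * dv) * Cexp (a * u t + b * v t))%C.
Proof.
intros Hu Hv.
assert (H1 : forall p q, is_derive (fun t => p * u t + q * v t) t (p * du + q * dv)).
{ intros p q; apply (is_derive_plus (fun t => p * u t) (fun t => q * v t));
  apply is_derive_scal; trivial; intros; apply Rmult_comm. }
destruct a as [a1 a2], b as [b1 b2].
apply (is_derive_ext (V := C_R_NormedModule)
  (fun t => (exp (a1 * u t + b1 * v t) * cos (a2 * u t + b2 * v t),
             exp (a1 * u t + b1 * v t) * sin (a2 * u t + b2 * v t)))).
{ intros s; unfold Cexp; simpl.
  replace (a1 * u s - a2 * 0 + (b1 * v s - b2 * 0)) with (a1 * u s + b1 * v s) by ring.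
  replace (a1 * 0 + a2 * u s + (b1 * 0 + b2 * v s)) with (a2 * u s + b2 * v s) by ring.
  reflexivity. }
set (p := fun t => a1 * u t + b1 * v t).
set (q := fun t => a2 * u t + b2 * v t).
set (dp := a1 * du + b1 * dv); set (dq := a2 * du + b2 * dv).
pose proof (H1 a1 b1 : is_derive p t dp) as Hp.
pose proof (H1 a2 b2 : is_derive q t dq) as Hq.
evar_last.
{ apply is_derive_C.
  - apply (is_derive_mult (fun t => exp (p t)) (fun t => cos (q t))).
    + apply (is_derive_comp exp p); [apply is_derive_exp | exact Hp].
    + apply (is_derive_comp cos q); [apply is_derive_cos | exact Hq].
    + intros; apply Rmult_comm.
  - apply (is_derive_mult (fun t => exp (p t)) (fun t => sin (q t))).
    + apply (is_derive_comp exp p); [apply is_derive_exp | exact Hp].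
    + apply (is_derive_comp sin q); [apply is_derive_sin | exact Hq].
    + intros; apply Rmult_comm. }
unfold Cexp; simpl.
replace (a1 * u t - a2 * 0 + (b1 * v t - b2 * 0)) with (p t) by (unfold p; ring).
replace (a1 * 0 + a2 * u t + (b1 * 0 + b2 * v t)) with (q t) by (unfold q; ring).
unfold plus, mult, scal, dp, dq; simpl; unfold mult; simpl.
apply injective_projections; simpl; ring.
Qed.

Lemma continuous_Cexp (a b : C) (u v : R -> R) (t : R) :
  ex_derive u t -> ex_derive v t ->
  continuous (U := C_R_NormedModule) (fun t => Cexp (a * u t + b * v t)%C) t.
Proof.
intros [du Hu] [dv Hv].
apply (ex_derive_continuous (V := C_R_NormedModule)).
eexists; apply is_derive_Cexp; [exact Hu | exact Hv].
Qed.

Lemma filterlim_C_squeeze {T : Type} (F : (T -> Prop) -> Prop) {FF : Filter F}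
  (f : T -> C) (l : C) (g : T -> R) :
  F (fun t => Cmod (f t - l) <= g t) -> filterlim g F (locally 0) ->
  filterlim (U := C_R_NormedModule) f F (locally (l : C_R_NormedModule)).
Proof.
intros Hfg H; apply (filterlim_locally_ball_norm (K := R_AbsRing)
  (U := C_R_NormedModule) f l).
intros eps; generalize (filter_and _ _ Hfg (proj1 (filterlim_locally _ _) H eps)).
apply filter_imp; intros x [Hx Hg].
unfold ball_norm; rewrite <- Cmod_norm; change (Cmod (f x - l) < eps).
change (Rabs (g x - 0) < eps) in Hg; rewrite Rminus_0_r in Hg.
eapply Rle_lt_trans; [exact Hx|].
eapply Rle_lt_trans; [apply Rle_abs | exact Hg].
Qed.

(* D is an interval exhausted by the segments [x, y], for x near its left end
   along F and y near its right end along G. *)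
Record spans (F G : (R -> Prop) -> Prop) (D : R -> Prop) : Prop := {
  spans_convex : forall x y z, D x -> D y -> x <= z <= y -> D z;
  spans_left : F D;
  spans_right : G D;
  spans_order : filter_prod F G (fun ab => fst ab <= snd ab) }.

Lemma spans_0_oo : spans (at_right 0) (Rbar_locally p_infty) (fun t => 0 < t).
Proof.
split.
- intros; lra.
- exists posreal_one; intros; lra.
- exists 0; trivial.
- apply Filter_prod with (fun x => x < 1) (fun x => 1 < x).
  + exists posreal_one; intros y Hy Hy'; change (Rabs (y - 0) < 1) in Hy.
    apply Rabs_lt_between in Hy; lra.
  + exists 1; trivial.
  + simpl; intros; lra.
Qed.

Lemma spans_0_1 : spans (at_right 0) (at_left 1) (fun t => 0 < t < 1).
Proof.
assert (H1 : at_right 0 (fun t => 0 < t < 1/2)).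
{ exists (mkposreal (1/2) ltac:(lra)); intros y Hy Hy'; change (Rabs (y - 0) < 1/2) in Hy.
  apply Rabs_lt_between in Hy; lra. }
assert (H2 : at_left 1 (fun t => 1/2 < t < 1)).
{ exists (mkposreal (1/2) ltac:(lra)); intros y Hy Hy'; change (Rabs (y - 1) < 1/2) in Hy.
  apply Rabs_lt_between in Hy; lra. }
split.
- intros; lra.
- revert H1; apply filter_imp; intros; lra.
- revert H2; apply filter_imp; intros; lra.
- apply Filter_prod with (1 := H1) (2 := H2); simpl; intros; lra.
Qed.

Lemma spans_prod F G D {FF : Filter F} {FG : Filter G} : spans F G D ->
  filter_prod F G (fun ab => forall x,
    Rmin (fst ab) (snd ab) <= x <= Rmax (fst ab) (snd ab) -> D x).
Proof.
intros [conv HF HG _].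
apply Filter_prod with (1 := HF) (2 := HG); simpl; intros x y Hx Hy z.
unfold Rmin, Rmax; destruct (Rle_dec x y); apply conv; trivial.
Qed.

Lemma spans_prod_le F G D {FF : Filter F} {FG : Filter G} : spans F G D ->
  filter_prod F G (fun ab => forall x, fst ab <= x <= snd ab -> D x).
Proof.
intros H; generalize (filter_and _ _ (spans_order _ _ _ H) (spans_prod _ _ _ H)).
apply filter_imp; intros [a b]; simpl; intros [Hab Hx] x.
rewrite Rmin_left, Rmax_right in Hx by easy; apply Hx.
Qed.

Lemma is_RInt_gen_ext_on {V : NormedModule R_AbsRing} F G D {FF : Filter F}
  {FG : Filter G} (f g : R -> V) (l : V) : spans F G D ->
  (forall t, D t -> f t = g t) -> is_RInt_gen f F G l -> is_RInt_gen g F G l.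
Proof.
intros HD H; apply is_RInt_gen_ext; try assumption.
generalize (spans_prod _ _ _ HD); apply filter_imp.
intros [a b]; simpl; intros Hx x [H1 H2]; apply H, Hx; lra.
Qed.

Lemma is_RInt_gen_primitive {V : CompleteNormedModule R_AbsRing} F G D
  {FF : Filter F} {FG : Filter G} (P f : R -> V) (l0 l1 : V) :
  spans F G D ->
  (forall t, D t -> is_derive P t (f t)) -> (forall t, D t -> continuous f t) ->
  filterlim P F (locally l0) -> filterlim P G (locally l1) ->
  is_RInt_gen f F G (minus l1 l0).
Proof.
intros HD Hd Hc H0 H1; unfold is_RInt_gen.
apply filterlimi_lim_ext_loc with (f := fun ab => minus (P (snd ab)) (P (fst ab))).
- generalize (spans_prod _ _ _ HD); apply filter_imp.
  intros [a b]; simpl; intros Hx; apply is_RInt_derive; auto.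
- unfold minus; eapply filterlim_comp_2; [| | apply (filterlim_plus l1 (opp l0))].
  + eapply filterlim_comp; [apply filterlim_snd | exact H1].
  + eapply filterlim_comp; [eapply filterlim_comp; [apply filterlim_fst | exact H0]|].
    apply (filterlim_opp l0).
Qed.

(** The increments of the integral P from a base point are bounded by those of B. Since B converges
    at each end, P is Cauchy along both filters, and completeness gives its limits there. *)
Lemma ex_RInt_gen_dominated {V : CompleteNormedModule R_AbsRing} F G D
  {FF : ProperFilter F} {FG : ProperFilter G}
  (f : R -> V) (B b : R -> R) (l0 l1 : R) :
  spans F G D -> (forall t, D t -> continuous f t) ->
  (forall t, D t -> norm (f t) <= b t) ->
  (forall t, D t -> is_derive B t (b t)) -> (forall t, D t -> continuous b t) ->
  filterlim B F (locally l0) -> filterlim B G (locally l1) ->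
  ex_RInt_gen f F G.
Proof.
intros HD Hc Hn Hd Hb H0 H1.
destruct (filter_ex _ (spans_left _ _ _ HD)) as [x0 Dx0].
assert (conv : forall x y, D x -> D y -> forall z, Rmin x y <= z <= Rmax x y -> D z).
{ intros x y Hx Hy z; unfold Rmin, Rmax; destruct (Rle_dec x y);
  apply (spans_convex _ _ _ HD); trivial. }
assert (ex : forall x y, D x -> D y -> ex_RInt f x y).
{ intros x y Hx Hy; apply @ex_RInt_continuous; intros z Hz.
  apply Hc; eauto. }
set (P := fun x => RInt f x0 x).
assert (HP : forall x y, D x -> D y -> is_RInt f x y (minus (P y) (P x))).
{ intros x y Hx Hy; unfold P, minus.
  rewrite plus_comm.
  exact (is_RInt_Chasles f x x0 y _ _
    (is_RInt_swap f x x0 _ (RInt_correct f _ _ (ex _ _ Dx0 Hx)))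
    (RInt_correct f _ _ (ex _ _ Dx0 Hy))). }
assert (Hlt : forall x y, D x -> D y -> x <= y ->
  norm (minus (P y) (P x)) <= Rabs (B y - B x)).
{ intros x y Hx Hy Hxy; eapply Rle_trans; [|apply Rle_abs].
  refine (norm_RInt_le f b x y _ _ Hxy _ (HP x y Hx Hy) _).
  - intros z Hz; apply Hn; apply (spans_convex _ _ _ HD x y); trivial.
  - apply (is_RInt_derive B b); intros z Hz; [apply Hd | apply Hb]; eauto. }
assert (Hall : forall x y, D x -> D y ->
  norm (minus (P y) (P x)) <= Rabs (B y - B x)).
{ intros x y Hx Hy; destruct (Rle_dec x y) as [h|h]; [auto|].
  rewrite Rabs_minus_sym, <- norm_opp, opp_minus; apply Hlt; trivial; lra. }
assert (Hlim : forall H l, ProperFilter H -> H D -> filterlim B H (locally l) ->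
  exists y, filterlim P H (locally y)).
{ intros H l FH HDH HB; apply (filterlim_locally_cauchy (F := H)).
  intros eps.
  assert (HB' : exists y : R_CompleteNormedModule, filterlim B H (locally y)) by now exists l.
  destruct (proj2 (filterlim_locally_cauchy B) HB' eps) as [Q [HQ HQ']].
  exists (fun x => Q x /\ D x); split; [now apply filter_and|].
  intros u v [Qu Du] [Qv Dv]; apply (norm_compat1 (K := R_AbsRing) (V := V)).
  eapply Rle_lt_trans; [apply Hall; trivial|].
  apply HQ'; trivial. }
destruct (Hlim F l0) as [y0 Hy0]; trivial. { apply HD. }
destruct (Hlim G l1) as [y1 Hy1]; trivial. { apply HD. }
exists (minus y1 y0); unfold is_RInt_gen.
apply filterlimi_lim_ext_loc with (f := fun ab => minus (P (snd ab)) (P (fst ab))).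
- apply Filter_prod with (1 := spans_left _ _ _ HD) (2 := spans_right _ _ _ HD).
  simpl; intros; now apply HP.
- unfold minus; eapply filterlim_comp_2; [| | apply (filterlim_plus y1 (opp y0))].
  + eapply filterlim_comp; [apply filterlim_snd | exact Hy1].
  + eapply filterlim_comp; [eapply filterlim_comp; [apply filterlim_fst | exact Hy0]|].
    apply (filterlim_opp y0).
Qed.

Lemma is_RInt_gen_comp {V : CompleteNormedModule R_AbsRing} F G D F' G'
  {FF : Filter F} {FG : Filter G} (f : R -> V) (h dh : R -> R) (l : V) :
  spans F G D ->
  (forall t, D t -> continuous f (h t)) ->
  (forall t, D t -> is_derive h t (dh t) /\ continuous dh t) ->
  filterlim h F F' -> filterlim h G G' ->
  is_RInt_gen f F' G' l ->
  is_RInt_gen (fun t => scal (dh t) (f (h t))) F G l.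
Proof.
intros HD Hf Hh HF HG Hl P HP.
destruct (Hl P HP) as [Q S HQ HS HQS].
assert (Hab : filter_prod F G (fun ab => Q (h (fst ab)) /\ S (h (snd ab)))).
{ apply Filter_prod with (1 := HF _ HQ) (2 := HG _ HS); simpl; auto. }
generalize (filter_and _ _ (spans_prod _ _ _ HD) Hab).
unfold filtermapi; apply filter_imp.
intros [a b]; simpl; intros [Hx [Qa Sb]].
destruct (HQS _ _ Qa Sb) as [y [Hy Py]]; simpl in Hy.
exists y; split; trivial.
rewrite <- (is_RInt_unique _ _ _ _ Hy).
apply is_RInt_comp; auto.
Qed.

(** * Beta and Gamma kernels *)

(** Linearity over the real module covers real factors only; a complex factor mixes the two
    components, which are treated separately. *)
Lemma is_RInt_Cmult (k : C) (f : R -> C) (a b : R) (l : C) :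
  is_RInt (V := C_R_NormedModule) f a b l ->
  is_RInt (V := C_R_NormedModule) (fun t => k * f t)%C a b (k * l)%C.
Proof.
intros H; destruct k as [x y], l as [u v].
pose proof (is_RInt_fct_extend_fst (U := R_NormedModule) (V := R_NormedModule)
  f a b (u, v) H) as H1.
pose proof (is_RInt_fct_extend_snd (U := R_NormedModule) (V := R_NormedModule)
  f a b (u, v) H) as H2.
simpl in H1, H2.
apply (is_RInt_fct_extend_pair (U := R_NormedModule) (V := R_NormedModule)); simpl.
- apply (is_RInt_minus (V := R_NormedModule) (fun t => x * fst (f t)) (fun t => y * snd (f t)));
  now apply (is_RInt_scal (V := R_NormedModule)).
- apply (is_RInt_plus (V := R_NormedModule) (fun t => x * snd (f t)) (fun t => y * fst (f t)));
  now apply (is_RInt_scal (V := R_NormedModule)).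
Qed.

Lemma filterlim_Cmult (k l : C) :
  filterlim (T := C_R_NormedModule) (U := C_R_NormedModule) (fun z : C => k * z)%C
    (locally (l : C_R_NormedModule)) (locally ((k * l)%C : C_R_NormedModule)).
Proof.
apply (filterlim_scal_r (K := C_AbsRing) (V := C_NormedModule) k l).
Qed.

Lemma is_RInt_gen_Cmult F G {FF : Filter F} {FG : Filter G} (k : C) (f : R -> C) (l : C) :
  is_RInt_gen (V := C_R_NormedModule) f F G l ->
  is_RInt_gen (V := C_R_NormedModule) (fun t => k * f t)%C F G (k * l)%C.
Proof.
intros H P HP; generalize (H _ (filterlim_Cmult k l P HP)).
unfold filtermapi; apply filter_imp; intros ab [z [Hz Pz]].
exists (k * z)%C; split; trivial; now apply is_RInt_Cmult.
Qed.

Lemma is_RInt_gen_comp_C F G D F' G' {FF : Filter F} {FG : Filter G}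
  (f : R -> C) (h dh : R -> R) (l : C) :
  spans F G D ->
  (forall t, D t -> continuous (U := C_R_NormedModule) f (h t)) ->
  (forall t, D t -> is_derive h t (dh t) /\ continuous dh t) ->
  filterlim h F F' -> filterlim h G G' ->
  is_RInt_gen (V := C_R_NormedModule) f F' G' l ->
  is_RInt_gen (V := C_R_NormedModule) (fun t => dh t * f (h t))%C F G l.
Proof.
intros HD Hf Hh HF HG Hl.
apply (is_RInt_gen_ext_on (V := C_R_NormedModule) _ _ _
  (fun t => scal (dh t) (f (h t) : C_R_NormedModule)) _ _ HD).
- intros t _; destruct (f (h t)) as [u v]; unfold scal; simpl.
  unfold prod_scal, scal; simpl; unfold mult; simpl.
  apply injective_projections; simpl; ring.
- now apply (is_RInt_gen_comp (V := C_R_CompleteNormedModule) F G D F' G').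
Qed.

Lemma Rpower_pos (x y : R) : 0 < Rpower x y.
Proof. apply exp_pos. Qed.

Lemma Rpower_lim_0 (k : R) : 0 < k ->
  filterlim (fun t => Rpower t k) (at_right 0) (locally 0).
Proof.
intros Hk; apply filterlim_locally; intros eps.
pose proof (cond_pos eps) as He.
exists (mkposreal (Rpower eps (/ k)) (Rpower_pos _ _)); intros y Hy Hy'.
change (Rabs (y - 0) < Rpower eps (/ k)) in Hy.
change (Rabs (Rpower y k - 0) < eps).
rewrite Rminus_0_r, Rabs_pos_eq in * by (try apply Rlt_le, Rpower_pos; lra).
replace (pos eps) with (Rpower (Rpower eps (/ k)) k).
- unfold Rpower at 1 2; apply exp_increasing, Rmult_lt_compat_l; trivial.
  now apply ln_increasing.
- rewrite Rpower_mult, Rinv_l, Rpower_1; lra.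
Qed.

Lemma Rpower_lim_oo (k : R) : 0 < k ->
  filterlim (fun t => Rpower t (- k)) (Rbar_locally p_infty) (locally 0).
Proof.
intros Hk; apply filterlim_locally; intros eps.
pose proof (cond_pos eps) as He.
exists (Rpower eps (- / k)); intros y Hy.
change (Rabs (Rpower y (- k) - 0) < eps).
pose proof (Rpower_pos eps (- / k)).
rewrite Rminus_0_r, Rabs_pos_eq by (apply Rlt_le, Rpower_pos).
replace (pos eps) with (Rpower (Rpower eps (- / k)) (- k)).
- unfold Rpower at 1 2; apply exp_increasing, Rmult_lt_gt_compat_neg_l; try lra.
  now apply ln_increasing.
- rewrite Rpower_mult; replace (- / k * - k) with 1 by (field; lra).
  rewrite Rpower_1; lra.
Qed.

(* Of order t^(k-1) at 0 and t^(-k-1) at infinity, with an elementary bounded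
   primitive. *)
Definition majorant (k t : R) : R := Rpower t (k - 1) / (1 + Rpower t k) ^ 2.

Lemma is_derive_Rpower (k t : R) : 0 < t ->
  is_derive (fun t => Rpower t k) t (k * Rpower t (k - 1)).
Proof. intros Ht; apply is_derive_Reals; now apply derivable_pt_lim_power. Qed.

Lemma is_derive_majorant (k t : R) : 0 < k -> 0 < t ->
  is_derive (fun t => - / (k * (1 + Rpower t k))) t (majorant k t).
Proof.
intros Hk Ht; pose proof (Rpower_pos t k); unfold majorant.
pose proof (is_derive_Rpower k t Ht) as Hd.
evar_last.
- apply (is_derive_comp (fun u => - / (k * (1 + u))) (fun t => Rpower t k) t); [|exact Hd].
  auto_derive; [apply Rmult_integral_contrapositive_currified; lra | reflexivity].
- unfold scal; simpl; unfold mult; simpl; field; split; lra.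
Qed.

Lemma continuous_majorant (k t : R) : 0 < t -> continuous (majorant k) t.
Proof.
intros Ht; apply (ex_derive_continuous (V := R_NormedModule)).
pose proof (Rpower_pos t k).
apply (ex_derive_div (fun t => Rpower t (k - 1)) (fun t => (1 + Rpower t k) ^ 2)).
- eexists; now apply is_derive_Rpower.
- apply (ex_derive_comp (fun u => (1 + u) ^ 2) (fun t => Rpower t k)).
  + auto_derive; trivial.
  + eexists; now apply is_derive_Rpower.
- apply pow_nonzero; lra.
Qed.

Lemma majorant_primitive_lim_0 (k : R) : 0 < k ->
  filterlim (fun t => - / (k * (1 + Rpower t k))) (at_right 0) (locally (- / k)).
Proof.
intros Hk.
apply (filterlim_comp _ _ _ (fun t => Rpower t k) (fun u => - / (k * (1 + u)))
  _ (locally 0) _ (Rpower_lim_0 k Hk)).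
replace (- / k) with (- / (k * (1 + 0))) by (f_equal; f_equal; ring).
apply (ex_derive_continuous (V := R_NormedModule) (fun u => - / (k * (1 + u)))).
auto_derive; lra.
Qed.

Lemma majorant_primitive_lim_oo (k : R) : 0 < k ->
  filterlim (fun t => - / (k * (1 + Rpower t k))) (Rbar_locally p_infty) (locally 0).
Proof.
intros Hk.
(* In u = t^(-k) the primitive is - u / (k (u + 1)), smooth at the point u = 0 that corresponds to t
   = oo. *)
apply filterlim_ext with (fun t => (fun u => - (u / (k * (u + 1)))) (Rpower t (- k))).
{ intros t; simpl; rewrite Rpower_Ropp; pose proof (Rpower_pos t k); field; lra. }
apply (filterlim_comp _ _ _ (fun t => Rpower t (- k)) (fun u => - (u / (k * (u + 1))))
  _ (locally 0) _ (Rpower_lim_oo k Hk)).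
replace 0 with ((fun u => - (u / (k * (u + 1)))) 0) at 2 by (field; lra).
apply (ex_derive_continuous (V := R_NormedModule) (fun u => - (u / (k * (u + 1))))).
auto_derive; lra.
Qed.

Lemma is_RInt_gen_majorant (k : R) : 0 < k ->
  is_RInt_gen (majorant k) (at_right 0) (Rbar_locally p_infty) (/ k).
Proof.
intros Hk; replace (/ k) with (minus 0 (- / k)) by (unfold minus, plus, opp; simpl; ring).
apply (is_RInt_gen_primitive (V := R_CompleteNormedModule) _ _ _
  (fun t => - / (k * (1 + Rpower t k))) _ _ _ spans_0_oo).
- intros; now apply is_derive_majorant.
- intros; now apply continuous_majorant.
- now apply majorant_primitive_lim_0.
- now apply majorant_primitive_lim_oo.
Qed.

(** From t^(c-1) = t^(k-1) t^(c-k) and t <= 1 + t, the product is at most t^(k-1) (1 + t)^(-2k). The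
    4 comes from (1 + t)^k >= (1 + t^k) / 2, as (1 + t)^k is at least 1 and at least t^k. *)
Lemma beta_kernel_le_majorant (c k r t : R) : 0 < k <= c -> c + k <= r -> 0 < t ->
  Rpower t (c - 1) * Rpower (1 + t) (- r) <= 4 * majorant k t.
Proof.
intros Hk Hr Ht; unfold majorant.
replace (c - 1) with ((k - 1) + (c - k)) by ring; rewrite Rpower_plus.
pose proof (Rpower_pos t (k - 1)) as P1.
assert (H1 : Rpower t (c - k) <= Rpower (1 + t) (c - k)).
{ apply Rle_Rpower_l; lra. }
assert (H2 : Rpower t k <= Rpower (1 + t) k) by (apply Rle_Rpower_l; lra).
assert (H3 : 1 <= Rpower (1 + t) k).
{ rewrite <- (Rpower_O (1 + t)) at 1 by lra; apply Rle_Rpower; lra. }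
assert (H4 : Rpower (1 + t) (c - k) * Rpower (1 + t) (- r) <= / Rpower (1 + t) k ^ 2).
{ rewrite <- Rpower_plus; replace (/ Rpower (1 + t) k ^ 2) with (Rpower (1 + t) (- k + - k)).
  - apply Rle_Rpower; lra.
  - rewrite Rpower_plus, Rpower_Ropp; field; lra. }
set (A := Rpower t (k - 1)) in *; set (x := Rpower t k) in *.
set (y := Rpower (1 + t) k) in *.
assert (Hx : 0 < x) by apply Rpower_pos.
apply Rle_trans with (A * / y ^ 2).
- rewrite Rmult_assoc; apply Rmult_le_compat_l; [lra|].
  eapply Rle_trans; [|exact H4]; apply Rmult_le_compat_r; trivial.
  apply Rlt_le, Rpower_pos.
- replace (4 * (A / (1 + x) ^ 2)) with (A * (4 * / (1 + x) ^ 2)) by (field; lra).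
  apply Rmult_le_compat_l; [lra|].
  replace (4 * / (1 + x) ^ 2) with (/ ((1 + x) / 2) ^ 2) by (field; lra).
  apply Rinv_le_contravar; [apply pow_lt; lra | apply pow_incr; lra].
Qed.

Lemma ex_RInt_gen_majorant (k K : R) (f : R -> C) : 0 < k ->
  (forall t, 0 < t -> continuous (U := C_R_NormedModule) f t) ->
  (forall t, 0 < t -> Cmod (f t) <= K * majorant k t) ->
  ex_RInt_gen (V := C_R_NormedModule) f (at_right 0) (Rbar_locally p_infty).
Proof.
intros Hk Hc Hf.
apply (ex_RInt_gen_dominated (V := C_R_CompleteNormedModule)
  _ _ _ f (fun t => scal K (- / (k * (1 + Rpower t k)))) (fun t => K * majorant k t)
  (scal K (- / k)) (scal K 0) spans_0_oo); trivial.
- intros t Ht; rewrite <- Cmod_norm; auto.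
- intros t Ht; now apply is_derive_scal, is_derive_majorant.
- intros t Ht; apply (continuous_scal_r (V := R_NormedModule)), continuous_majorant, Ht.
- eapply filterlim_comp; [apply majorant_primitive_lim_0, Hk |
  apply (filterlim_scal_r (V := R_NormedModule))].
- eapply filterlim_comp; [apply majorant_primitive_lim_oo, Hk |
  apply (filterlim_scal_r (V := R_NormedModule))].
Qed.

Lemma Cmod_RInt_gen_majorant (k K : R) (f : R -> C) (l : C) : 0 < k ->
  (forall t, 0 < t -> Cmod (f t) <= K * majorant k t) ->
  is_RInt_gen (V := C_R_NormedModule) f (at_right 0) (Rbar_locally p_infty) l ->
  Cmod l <= K * / k.
Proof.
intros Hk Hf Hl; rewrite Cmod_norm.
apply (RInt_gen_norm (V := C_R_CompleteNormedModule) (Fa := at_right 0)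
  (Fb := Rbar_locally p_infty) f (fun t => K * majorant k t)); trivial.
- apply spans_0_oo.
- generalize (spans_prod_le _ _ _ spans_0_oo); apply filter_imp.
  intros ab H x Hx; rewrite <- Cmod_norm; auto.
- apply (is_RInt_gen_scal (V := R_NormedModule)), is_RInt_gen_majorant, Hk.
Qed.

(* t^(a-1) (1 + s t)^(-p) *)
Definition beta_kernel (a p : C) (s t : R) : C :=
  Cexp ((a - 1) * ln t + - p * ln (1 + s * t)).

Definition gamma_kernel (a : C) (t : R) : C := Cexp ((a - 1) * ln t + - (1) * t).

Lemma ex_derive_ln (t : R) : 0 < t -> ex_derive ln t.
Proof. intros Ht; eexists; now apply is_derive_ln. Qed.

Lemma continuous_beta_kernel (a p : C) (s t : R) : 0 < s -> 0 < t ->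
  continuous (U := C_R_NormedModule) (beta_kernel a p s) t.
Proof.
intros Hs Ht; apply (continuous_Cexp (a - 1) (- p) ln (fun t => ln (1 + s * t))).
- now apply ex_derive_ln.
- auto_derive; pose proof (Rmult_lt_0_compat _ _ Hs Ht); lra.
Qed.

Lemma continuous_gamma_kernel (a : C) (t : R) : 0 < t ->
  continuous (U := C_R_NormedModule) (gamma_kernel a) t.
Proof.
intros Ht; apply (continuous_Cexp (a - 1) (- (1)) ln (fun t => t)).
- now apply ex_derive_ln.
- auto_derive; trivial.
Qed.

Lemma Cmod_beta_kernel (a p : C) (s t : R) : 0 < s -> 0 < t ->
  Cmod (beta_kernel a p s t) = Rpower t (Re a - 1) * Rpower (1 + s * t) (- Re p).
Proof.
intros Hs Ht; unfold beta_kernel; rewrite Cmod_Cexp; unfold Rpower; rewrite <- exp_plus.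
f_equal; destruct a, p; simpl; ring.
Qed.

Lemma Cmod_gamma_kernel (a : C) (t : R) : 0 < t ->
  Cmod (gamma_kernel a t) = Rpower t (Re a - 1) * exp (- t).
Proof.
intros Ht; unfold gamma_kernel; rewrite Cmod_Cexp; unfold Rpower; rewrite <- exp_plus.
f_equal; destruct a; simpl; ring.
Qed.

(** Euler's B(a, b) in the form over the half-line; the form over (0, 1) is recovered in
    [is_RInt_gen_beta_0_1]. *)
Definition beta (a b : C) : C :=
  RInt_gen (V := C_R_CompleteNormedModule) (beta_kernel a (a + b) 1)
    (at_right 0) (Rbar_locally p_infty).

Lemma is_RInt_gen_beta (a b : C) : 0 < Re a -> 0 < Re b ->
  is_RInt_gen (V := C_R_NormedModule) (beta_kernel a (a + b) 1)
    (at_right 0) (Rbar_locally p_infty) (beta a b).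
Proof.
intros Ha Hb.
apply (RInt_gen_correct (V := C_R_CompleteNormedModule) (beta_kernel a (a + b) 1)).
(* Re a governs integrability at 0 and Re b at infinity, so the exponent of the majorant is their
   minimum. *)
pose proof (Rmin_l (Re a) (Re b)); pose proof (Rmin_r (Re a) (Re b)).
apply (ex_RInt_gen_majorant (Rmin (Re a) (Re b)) 4).
- now apply Rmin_pos.
- intros t Ht; apply continuous_beta_kernel; lra.
- intros t Ht; rewrite Cmod_beta_kernel, Rmult_1_l by lra.
  apply beta_kernel_le_majorant; trivial.
  + split; [now apply Rmin_pos | trivial].
  + destruct a, b; simpl in *; lra.
Qed.

(** * Inequalities for ln (1 + x) *)

Lemma ln_lower (x : R) : 0 <= x -> x / (1 + x) <= ln (1 + x).
Proof.
intros Hx; replace (ln (1 + x)) with (- ln (/ (1 + x))).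
- pose proof (exp_ineq1_le (ln (/ (1 + x)))) as H.
  rewrite exp_ln in H by (apply Rinv_0_lt_compat; lra).
  replace (x / (1 + x)) with (1 - / (1 + x)) by (field; lra); lra.
- rewrite ln_Rinv; lra.
Qed.

Lemma ln_upper (x : R) : 0 <= x -> ln (1 + x) <= x.
Proof.
intros Hx; pose proof (exp_ineq1_le (ln (1 + x))) as H.
rewrite exp_ln in H; lra.
Qed.

Lemma ln_lower_2 (x : R) : 0 <= x -> x - x * x <= ln (1 + x).
Proof.
intros Hx; apply Rle_trans with (2 := ln_lower x Hx).
apply Rmult_le_reg_r with (1 + x); [lra|].
unfold Rdiv; rewrite Rmult_assoc, Rinv_l by lra; nra.
Qed.

(** Bernoulli's inequality in logarithmic form. It follows from ln y <= y - 1 at y = (1 + r x) / (1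
    + x) = 1 + (r - 1) x / (1 + x), together with [ln_lower]. *)
Lemma ln_bernoulli (x r : R) : 0 <= x -> 1 <= r -> ln (1 + r * x) <= r * ln (1 + x).
Proof.
intros Hx Hr.
assert (0 <= r * x) by (apply Rmult_le_pos; lra).
pose proof (exp_ineq1_le (ln ((1 + r * x) / (1 + x)))) as H1.
assert (0 < (1 + r * x) / (1 + x)) by (apply Rdiv_lt_0_compat; lra).
rewrite exp_ln in H1 by easy.
rewrite ln_div in H1 by lra.
pose proof (ln_lower x Hx) as H2.
replace ((1 + r * x) / (1 + x)) with (1 + (r - 1) * (x / (1 + x))) in H1 by (field; lra).
assert ((r - 1) * (x / (1 + x)) <= (r - 1) * ln (1 + x)) by (apply Rmult_le_compat_l; lra).
lra.
Qed.

(** A bound on (1 + t / N)^(-N) uniform in N: by Bernoulli with exponent N / M it is at most (1 + t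
    / M)^(-M), and 1 + t / M >= (1 + t) / M because M >= 1. *)
Lemma decay_bound (M N t : R) : 1 <= M <= N -> 0 <= t ->
  exp (- (N * ln (1 + / N * t))) <= Rpower M M * Rpower (1 + t) (- M).
Proof.
intros HM Ht.
assert (H1 : M * ln (1 + / M * t) <= N * ln (1 + / N * t)).
{ pose proof (ln_bernoulli (/ N * t) (N / M)) as H.
  replace (N / M * (/ N * t)) with (/ M * t) in H by (field; lra).
  apply Rle_trans with (M * (N / M * ln (1 + / N * t))).
  - apply Rmult_le_compat_l; [lra|]; apply H.
    + apply Rmult_le_pos; [apply Rlt_le, Rinv_0_lt_compat|]; lra.
    + apply Rmult_le_reg_r with M; [lra|]; unfold Rdiv; rewrite Rmult_assoc, Rinv_l; lra.
  - apply Req_le; field; lra. }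
unfold Rpower; rewrite <- exp_plus.
assert (H2 : ln (1 + t) - ln M <= ln (1 + / M * t)).
{ rewrite <- ln_div by lra; apply ln_le.
  - apply Rdiv_lt_0_compat; lra.
  - replace ((1 + t) / M) with (/ M + / M * t) by (field; lra).
    apply Rplus_le_compat_r; rewrite <- Rinv_1; apply Rinv_le_contravar; lra. }

assert (M * (ln (1 + t) - ln M) <= M * ln (1 + / M * t)) by (apply Rmult_le_compat_l; lra).
destruct (Rle_lt_or_eq_dec (- (N * ln (1 + / N * t))) (M * ln M + - M * ln (1 + t))) as [h|h].
- lra.
- now apply Rlt_le, exp_increasing.
- rewrite h; apply Rle_refl.
Qed.

(** * Euler's Beta integral *)

Lemma Rabs_sin_le (x : R) : Rabs (sin x) <= Rabs x.
Proof.
assert (Hpos : forall y, 0 < y -> Rabs (sin y) <= y).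
{ intros y Hy; apply Rabs_le; split; [|now apply Rlt_le, sin_lt_x].
  destruct (Rle_dec y 1).
  - assert (0 <= sin y); [|lra]; apply sin_ge_0; pose proof PI2_1; lra.
  - pose proof (SIN_bound y); lra. }
destruct (Rtotal_order x 0) as [h|[->|h]].
- rewrite <- Rabs_Ropp, <- sin_neg, (Rabs_left x) by easy; apply Hpos; lra.
- rewrite sin_0; apply Rle_refl.
- rewrite (Rabs_pos_eq x) by lra; now apply Hpos.
Qed.

Lemma exp_neg_bounds (x : R) : 0 <= x -> 0 <= 1 - exp (- x) <= x.
Proof.
intros Hx; pose proof (exp_ineq1_le (- x)); split; [|lra].
rewrite <- exp_0 at 1.
destruct Hx as [Hx| <- ]; [|rewrite Ropp_0; lra].
pose proof (exp_increasing (- x) 0 ltac:(lra)); lra.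
Qed.

(** With z = p + i q and e = exp (-p) <= 1, the square of the left side is (1 - e)^2 + 2 e (1 - cos
    q), while 1 - e <= p and 1 - cos q <= q^2 / 2. *)
Lemma Cmod_Cexp_minus_1 (z : C) : 0 <= Re z -> Cmod (Cexp (- z) - 1) <= Cmod z.
Proof.
destruct z as [p q]; simpl; intros Hp.
pose proof (exp_neg_bounds p Hp) as He.
assert (Hc : 0 <= 1 - cos q <= q * q / 2).
{ pose proof (Rabs_sin_le (q / 2)) as Hs.
  apply Rsqr_le_abs_1 in Hs; unfold Rsqr in Hs.
  replace (cos q) with (1 - 2 * (sin (q / 2) * sin (q / 2))).
  - pose proof (Rle_0_sqr (sin (q / 2))) as H0; unfold Rsqr in H0; lra.
  - replace q with (2 * (q / 2)) at 3 by field; rewrite cos_2a_sin; ring. }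
apply Rsqr_incr_0_var; [|apply Cmod_ge_0].
unfold Cmod, Rsqr; rewrite !sqrt_sqrt; simpl; try (apply Rplus_le_le_0_compat; apply (pow2_ge_0 _)).
rewrite cos_neg, sin_neg.
set (e := exp (- p)) in *.
pose proof (sin2_cos2 q) as Hsc; unfold Rsqr in Hsc.
assert (e * (1 - cos q) <= q * q / 2).
{ apply Rle_trans with (1 * (1 - cos q)); [|lra].
  apply Rmult_le_compat_r; lra. }
assert (e * e * (sin q * sin q + cos q * cos q) = e * e) by (rewrite Hsc; ring).
assert ((1 - e) * (1 - e) <= p * p) by (apply Rmult_le_compat; lra).
match goal with |- ?x <= _ =>
  replace x with (e * e * (sin q * sin q + cos q * cos q) - 2 * (e * cos q) + 1) by ring end.
lra.
Qed.

Lemma beta_kernel_approx_gamma_kernel (a w : C) (N t : R) : 0 <= Re w -> 0 < N -> 0 < t ->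
  Cmod (beta_kernel a (w + N) (/ N) t - gamma_kernel a t) <=
  / N * ((Cmod w * t + t * t) * (Rpower t (Re a - 1) * exp (- (N * ln (1 + / N * t))))).
Proof.
intros Hw HN Ht.
assert (HNt : 0 < / N * t) by (apply Rmult_lt_0_compat; trivial; now apply Rinv_0_lt_compat).
set (L := ln (1 + / N * t)).
assert (HL : 0 <= L <= / N * t).
{ split; [|apply ln_upper; lra].
  eapply Rle_trans; [|apply ln_lower; lra].
  apply Rlt_le, Rdiv_lt_0_compat; lra. }
assert (HL2 : 0 <= t - N * L <= / N * (t * t)).
{ pose proof (ln_lower_2 (/ N * t) ltac:(lra)) as H; fold L in H.
  replace (t - N * L) with (N * (/ N * t - L)) by (field; lra).
  replace (/ N * (t * t)) with (N * ((/ N * t) * (/ N * t))) by (field; lra).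
  split; [apply Rmult_le_pos | apply Rmult_le_compat_l]; lra. }
(* The common factor t^(a-1) exp (- N L) is pulled out. Subtracting 1 from both remaining
   exponentials reduces the error to the exponents w L and t - N L, which have nonnegative real part
   and modulus at most |w| t / N and t^2 / N. *)
replace (beta_kernel a (w + N) (/ N) t - gamma_kernel a t)%C with
  (Cexp ((a - 1) * ln t) * (Cexp (RtoC (- (N * L))) *
     ((Cexp (- (w * L)) - 1) - (Cexp (- RtoC (t - N * L)) - 1))))%C.
2:{ unfold beta_kernel, gamma_kernel; fold L.
  replace ((a - 1) * ln t + - (w + N) * L)%C with
    ((a - 1) * ln t + (RtoC (- (N * L)) + - (w * L)))%C
    by (rewrite RtoC_opp, RtoC_mult; ring).
  replace ((a - 1) * ln t + - (1) * t)%C with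
    ((a - 1) * ln t + (RtoC (- (N * L)) + - RtoC (t - N * L)))%C
    by (rewrite RtoC_opp, RtoC_minus, RtoC_mult; ring).
  rewrite !Cexp_plus; ring. }
rewrite !Cmod_mult, !Cmod_Cexp.
replace (exp (Re ((a - 1) * ln t))) with (Rpower t (Re a - 1))
  by (unfold Rpower; f_equal; destruct a; simpl; ring).
simpl (Re (RtoC _)).
assert (H : Cmod (Cexp (- (w * L)) - 1 - (Cexp (- RtoC (t - N * L)) - 1))
  <= / N * (Cmod w * t + t * t)).
{ eapply Rle_trans; [apply Cmod_triangle|]; rewrite Cmod_opp.
  pose proof (Cmod_Cexp_minus_1 (w * L)) as H1.
  pose proof (Cmod_Cexp_minus_1 (RtoC (t - N * L))) as H2.
  rewrite Cmod_mult, Cmod_R, Rabs_pos_eq in H1 by easy.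
  rewrite Cmod_R, Rabs_pos_eq in H2 by easy.
  assert (0 <= Re (w * L)).
  { destruct w; simpl in *; rewrite Rmult_0_r, Rminus_0_r; apply Rmult_le_pos; lra. }
  specialize (H1 ltac:(trivial)); specialize (H2 ltac:(simpl; lra)).
  assert (Cmod w * L <= Cmod w * (/ N * t)).
  { apply Rmult_le_compat_l; [apply Cmod_ge_0 | lra]. }
  lra. }
pose proof (Rpower_pos t (Re a - 1)); pose proof (exp_pos (- (N * L))).
assert (0 < Rpower t (Re a - 1) * exp (- (N * L))) by now apply Rmult_lt_0_compat.
rewrite <- Rmult_assoc.
eapply Rle_trans; [apply Rmult_le_compat_l, H; lra|].
apply Req_le; ring.
Qed.

Lemma scaled_beta_kernel_le_majorant (a : C) (M N t : R) :
  0 < Re a -> 2 * Re a <= M -> 1 <= M <= N -> 0 < t ->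
  Rpower t (Re a - 1) * exp (- (N * ln (1 + / N * t))) <=
  Rpower M M * (4 * majorant (Re a) t).
Proof.
intros Ha HM HN Ht.
pose proof (decay_bound M N t HN ltac:(lra)).
pose proof (beta_kernel_le_majorant (Re a) (Re a) M t ltac:(lra) ltac:(lra) Ht).
pose proof (Rpower_pos t (Re a - 1)); pose proof (Rpower_pos M M).
apply Rle_trans with (Rpower t (Re a - 1) * (Rpower M M * Rpower (1 + t) (- M))).
- apply Rmult_le_compat_l; lra.
- replace (Rpower t (Re a - 1) * (Rpower M M * Rpower (1 + t) (- M)))
    with (Rpower M M * (Rpower t (Re a - 1) * Rpower (1 + t) (- M))) by ring.
  apply Rmult_le_compat_l; lra.
Qed.

Lemma gamma_kernel_le_majorant (a : C) (M t : R) : 0 < Re a -> 2 * Re a <= M -> 1 <= M -> 0 < t ->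
  Cmod (gamma_kernel a t) <= (Rpower M M * 4) * majorant (Re a) t.
Proof.
intros Ha HM HM' Ht; rewrite Cmod_gamma_kernel, Rmult_assoc by easy.
(* Taking N = M suffices, since exp (- t) <= (1 + t / M)^(-M). *)
eapply Rle_trans; [|apply (scaled_beta_kernel_le_majorant a M M t); lra].
apply Rmult_le_compat_l; [apply Rlt_le, Rpower_pos|].
assert (ln (1 + / M * t) <= / M * t).
{ apply ln_upper, Rmult_le_pos; [apply Rlt_le, Rinv_0_lt_compat|]; lra. }
assert (H1 : M * ln (1 + / M * t) <= M * (/ M * t)) by (apply Rmult_le_compat_l; lra).
rewrite <- Rmult_assoc, Rinv_r, Rmult_1_l in H1 by lra.
destruct H1 as [H1| -> ]; [apply Rlt_le, exp_increasing; lra | apply Rle_refl].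
Qed.

Lemma is_RInt_gen_Gamma (a : C) : 0 < Re a ->
  is_RInt_gen (V := C_R_NormedModule) (gamma_kernel a)
    (at_right 0) (Rbar_locally p_infty) (Gamma_integral a).
Proof.
intros Ha.
assert (Heq : forall t, 0 < t -> gamma_kernel a t = (Cpower t (a - 1) * exp (- t))%C).
{ intros t Ht; unfold gamma_kernel; rewrite Cexp_plus, Cpower_pos, <- Cexp_RtoC by easy.
  rewrite RtoC_opp; do 2 f_equal; ring. }
assert (ex_RInt_gen (V := C_R_NormedModule) (gamma_kernel a)
  (at_right 0) (Rbar_locally p_infty)) as [l Hl].
{ apply (ex_RInt_gen_majorant (Re a) (Rpower (2 * Re a + 1) (2 * Re a + 1) * 4)); trivial.
  - intros; now apply continuous_gamma_kernel.
  - intros; apply gamma_kernel_le_majorant; lra. }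
apply (is_RInt_gen_ext_on (V := C_R_NormedModule) _ _ _
  (fun t => Cpower t (a - 1) * exp (- t))%C _ _ spans_0_oo).
{ intros; symmetry; now apply Heq. }
apply (RInt_gen_correct (V := C_R_CompleteNormedModule)
  (fun t => Cpower t (a - 1) * exp (- t))%C).
exists l; revert Hl.
apply (is_RInt_gen_ext_on (V := C_R_NormedModule) _ _ _ _ _ _ spans_0_oo Heq).
Qed.

Lemma beta_kernel_scaling (a p : C) (N : R) (l : C) : 0 < N ->
  is_RInt_gen (V := C_R_NormedModule) (beta_kernel a p 1)
    (at_right 0) (Rbar_locally p_infty) l ->
  is_RInt_gen (V := C_R_NormedModule) (beta_kernel a p (/ N))
    (at_right 0) (Rbar_locally p_infty) (Cpower N a * l)%C.
Proof.
intros HN Hl; assert (HN' := Rinv_0_lt_compat _ HN).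
apply (is_RInt_gen_ext_on (V := C_R_NormedModule) _ _ _
  (fun t => Cpower N a * (RtoC (/ N) * beta_kernel a p 1 (/ N * t)))%C
  _ _ spans_0_oo).
{ intros t Ht.
  replace (RtoC (/ N)) with (Cexp (- RtoC (ln N))).
  2:{ rewrite <- RtoC_opp, Cexp_RtoC, exp_Ropp, exp_ln by easy; reflexivity. }
  unfold beta_kernel; rewrite Cpower_pos, <- !Cexp_plus by easy; f_equal.
  rewrite ln_mult, ln_Rinv, RtoC_plus, RtoC_opp, Rmult_1_l by easy; ring. }
apply is_RInt_gen_Cmult; try typeclasses eauto.
apply (is_RInt_gen_comp_C _ _ _ (at_right 0)
  (Rbar_locally p_infty) (beta_kernel a p 1) (fun t => / N * t) (fun _ => / N) l
  spans_0_oo); trivial.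
- intros t Ht; apply continuous_beta_kernel; [lra | now apply Rmult_lt_0_compat].
- intros t Ht; split; [auto_derive; trivial; ring | apply continuous_const].
- intros P [e He].
  exists (mkposreal (N * e) (Rmult_lt_0_compat _ _ HN (cond_pos e))); intros y Hy Hy'.
  apply He; [|now apply Rmult_lt_0_compat].
  change (Rabs (y - 0) < N * e) in Hy; change (Rabs (/ N * y - 0) < e).
  rewrite Rminus_0_r, Rabs_pos_eq in * by (try apply Rmult_le_pos; lra).
  apply Rmult_lt_reg_l with N; trivial.
  rewrite <- Rmult_assoc, Rinv_r, Rmult_1_l; lra.
- intros P [M HM]; exists (N * M); intros y Hy; apply HM.
  apply Rmult_lt_reg_l with N; trivial.
  rewrite <- Rmult_assoc, Rinv_r, Rmult_1_l; lra.
Qed.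

Lemma gamma_limit_bound (a b : C) : 0 < Re a -> 0 < Re b ->
  exists K M : R, forall N : R, M <= N ->
    Cmod (Cpower N a * beta a (b + N) - Gamma_integral a) <= / N * K.
Proof.
intros Ha Hb.
(* The error carries the extra factor W t + t^2 <= (W + 1) (1 + t)^2; the 2 added to 2 Re a pays for
   (1 + t)^2 and leaves a decay of order 2 Re a. *)
set (M := 2 * Re a + 2); set (W := Cmod (a + b)).
exists ((W + 1) * (Rpower M M * 4) * / Re a), M; intros N HN.
assert (HN0 : 0 < N) by (unfold M in HN; lra).
assert (HW : 0 <= W) by apply Cmod_ge_0.
pose proof (Rpower_pos M M) as HMM.
rewrite <- Rmult_assoc.
apply (Cmod_RInt_gen_majorant (Re a) (/ N * ((W + 1) * (Rpower M M * 4)))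
  (fun t => beta_kernel a (a + b + N) (/ N) t - gamma_kernel a t)%C); trivial.
- intros t Ht.
  eapply Rle_trans.
  { apply beta_kernel_approx_gamma_kernel; trivial; destruct a, b; simpl in *; lra. }
  rewrite Rmult_assoc; apply Rmult_le_compat_l; [now apply Rlt_le, Rinv_0_lt_compat|].
  fold W; rewrite (Rmult_assoc (W + 1)), (Rmult_assoc (Rpower M M)).
  pose proof (decay_bound M N t ltac:(unfold M in *; lra) ltac:(lra)) as Hd.
  pose proof (beta_kernel_le_majorant (Re a) (Re a) (M - 2) t
    ltac:(lra) ltac:(unfold M; lra) Ht) as Hk.
  pose proof (Rpower_pos t (Re a - 1)) as Hp.
  pose proof (Rpower_pos (1 + t) (- M)) as Hq.
  assert (E : Rpower (1 + t) (- (M - 2)) = (1 + t) ^ 2 * Rpower (1 + t) (- M)).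
  { rewrite <- (Rpower_pow 2 (1 + t)), <- Rpower_plus by lra; f_equal; simpl; ring. }
  rewrite E in Hk.
  set (e := exp _) in *; set (p := Rpower t _) in *; set (q := Rpower (1 + t) (- M)) in *.
  apply Rle_trans with ((W + 1) * (1 + t) ^ 2 * (p * (Rpower M M * q))).
  + apply Rmult_le_compat.
    * apply Rplus_le_le_0_compat; apply Rmult_le_pos; lra.
    * apply Rlt_le, Rmult_lt_0_compat; trivial; apply exp_pos.
    * simpl; nra.
    * apply Rmult_le_compat_l; lra.
  + replace ((W + 1) * (1 + t) ^ 2 * (p * (Rpower M M * q))) with
      ((W + 1) * (Rpower M M * (p * ((1 + t) ^ 2 * q)))) by ring.
    apply Rmult_le_compat_l; [lra|]; apply Rmult_le_compat_l; lra.
- apply (is_RInt_gen_minus (V := C_R_NormedModule)).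
  + apply beta_kernel_scaling; trivial; rewrite <- Cplus_assoc.
    apply is_RInt_gen_beta; trivial; destruct b; simpl in *; lra.
  + now apply is_RInt_gen_Gamma.
Qed.

Lemma gamma_limit (a b : C) : 0 < Re a -> 0 < Re b ->
  filterlim (U := C_R_NormedModule)
    (fun n => Cpower (INR n) a * beta a (b + INR n))%C eventually
    (locally (Gamma_integral a : C_R_NormedModule)).
Proof.
intros Ha Hb.
destruct (gamma_limit_bound a b Ha Hb) as [K [M H]].
apply filterlim_C_squeeze with (g := fun n => / INR n * K).
- exact _.
- pose proof (proj2 (is_lim_seq_spec _ p_infty) is_lim_seq_INR M) as HM.
  revert HM; apply filter_imp; intros n Hn; apply H; lra.
- assert (HK : is_lim_seq (fun n => / INR n * K) (Rbar_mult 0 K)).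
  { apply is_lim_seq_scal_r.
    apply (is_lim_seq_inv INR p_infty); [apply is_lim_seq_INR | discriminate]. }
  simpl in HK; rewrite Rmult_0_l in HK; exact HK.
Qed.

(** * Recurrences of the Beta integral *)

Lemma Cminus_0_r (z : C) : (z - 0)%C = z.
Proof. ring. Qed.

Lemma Cone_plus_neq_0 (t : R) : 0 < t -> (1 + RtoC t)%C <> 0.
Proof. intros Ht H; apply (f_equal Re) in H; simpl in H; lra. Qed.

Lemma Cneq_0_Re (z : C) : 0 < Re z -> z <> RtoC 0.
Proof. intros H E; rewrite E in H; simpl in H; lra. Qed.

Lemma Cexp_ln (t : R) : 0 < t -> Cexp (ln t) = t.
Proof. intros Ht; rewrite Cexp_RtoC, exp_ln; trivial. Qed.

Lemma Cexp_opp (z : C) : Cexp (- z) = (/ Cexp z)%C.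
Proof.
assert (H : (Cexp z * Cexp (- z))%C = 1).
{ rewrite <- Cexp_plus, <- Cexp_0; f_equal; ring. }
assert (Cexp z <> 0).
{ intros E; rewrite E, Cmult_0_l in H; apply (f_equal Re) in H; simpl in H; lra. }
rewrite <- (Cmult_1_l (/ Cexp z)), <- H; field; trivial.
Qed.

Lemma beta_kernel_succ_l (a p : C) (t : R) : 0 < t ->
  beta_kernel (a + 1) p 1 t = (t * beta_kernel a p 1 t)%C.
Proof.
intros Ht; rewrite <- (Cexp_ln t) by easy; unfold beta_kernel; rewrite <- Cexp_plus.
f_equal; ring.
Qed.

Lemma beta_kernel_succ_r (a p : C) (t : R) : 0 < t ->
  beta_kernel a (p + 1) 1 t = (beta_kernel a p 1 t / (1 + t))%C.
Proof.
intros Ht; unfold Cdiv.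
replace (1 + RtoC t)%C with (Cexp (ln (1 + 1 * t))).
- rewrite <- Cexp_opp; unfold beta_kernel; rewrite <- Cexp_plus; f_equal; ring.
- rewrite Cexp_ln by lra; rewrite Rmult_1_l, RtoC_plus; reflexivity.
Qed.

(** The term - p t^a (1 + t)^(-p-1) is rewritten with t / (1 + t) = 1 - 1 / (1 + t), so that both
    kernels keep the exponent a - 1 of t and only the power of 1 + t changes. *)
Lemma is_derive_beta_kernel (a p : C) (t : R) : 0 < t ->
  is_derive (V := C_R_NormedModule) (beta_kernel (a + 1) p 1) t
    ((a - p) * beta_kernel a p 1 t + p * beta_kernel a (p + 1) 1 t)%C.
Proof.
intros Ht.
replace ((a - p) * beta_kernel a p 1 t + p * beta_kernel a (p + 1) 1 t)%C with
  (((a + 1 - 1) * RtoC (/ t) + - p * RtoC (/ (1 + 1 * t))) * beta_kernel (a + 1) p 1 t)%C.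
- apply (is_derive_Cexp (a + 1 - 1) (- p) ln (fun t => ln (1 + 1 * t))).
  + now apply is_derive_ln.
  + auto_derive; lra || (field; lra).
- rewrite beta_kernel_succ_l, beta_kernel_succ_r by easy.
  rewrite !RtoC_inv by lra; rewrite Rmult_1_l, RtoC_plus.
  field; split; [now apply Cone_plus_neq_0 | apply Cneq_0_Re; trivial].
Qed.

Lemma beta_kernel_lim_0 (a p : C) : 0 < Re a -> 0 <= Re p ->
  filterlim (U := C_R_NormedModule) (beta_kernel (a + 1) p 1) (at_right 0)
    (locally (RtoC 0 : C_R_NormedModule)).
Proof.
intros Ha Hp.
apply filterlim_C_squeeze with (g := fun t => Rpower t (Re a)).
- exact _.
- generalize (spans_left _ _ _ spans_0_oo); apply @filter_imp; [exact _|]; intros t Ht.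
  rewrite Cminus_0_r, Cmod_beta_kernel by lra.
  replace (Re (a + 1) - 1) with (Re a) by (destruct a; simpl; ring).
  rewrite <- (Rmult_1_r (Rpower t (Re a))) at 2.
  apply Rmult_le_compat_l; [apply Rlt_le, Rpower_pos|].
  apply Rle_trans with (Rpower (1 + 1 * t) 0); [apply Rle_Rpower; lra|].
  rewrite Rpower_O; lra.
- now apply Rpower_lim_0.
Qed.

Lemma beta_kernel_lim_oo (a p : C) : 0 <= Re a -> Re a < Re p ->
  filterlim (U := C_R_NormedModule) (beta_kernel (a + 1) p 1) (Rbar_locally p_infty)
    (locally (RtoC 0 : C_R_NormedModule)).
Proof.
intros Ha Hp.
apply filterlim_C_squeeze with (g := fun t => Rpower t (- (Re p - Re a))).
- exact _.
- generalize (spans_right _ _ _ spans_0_oo); apply @filter_imp; [exact _|]; intros t Ht.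
  rewrite Cminus_0_r, Cmod_beta_kernel by lra.
  replace (Re (a + 1) - 1) with (Re a) by (destruct a; simpl; ring).
  apply Rle_trans with (Rpower t (Re a) * Rpower t (- Re p)).
  + apply Rmult_le_compat_l; [apply Rlt_le, Rpower_pos|].
    rewrite !Rpower_Ropp; apply Rinv_le_contravar; [apply Rpower_pos|].
    apply Rle_Rpower_l; lra.
  + rewrite <- Rpower_plus; apply Req_le; f_equal; ring.
- apply Rpower_lim_oo; lra.
Qed.

(** Integration by parts with p = a + b: the primitive t^a (1 + t)^(-a-b) vanishes at 0 since Re a >
    0 and at infinity since Re b > 0. *)
Lemma beta_recurrence (a b : C) : 0 < Re a -> 0 < Re b ->
  ((a + b) * beta a (b + 1) = b * beta a b)%C.
Proof.
intros Ha Hb.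
assert (H0 : is_RInt_gen (V := C_R_NormedModule)
  (fun t => (a - (a + b)) * beta_kernel a (a + b) 1 t + (a + b) * beta_kernel a (a + b + 1) 1 t)%C
  (at_right 0) (Rbar_locally p_infty) (RtoC 0)).
{ replace (RtoC 0) with (minus (RtoC 0 : C_R_NormedModule) (RtoC 0 : C_R_NormedModule))
    by apply (minus_eq_zero (G := C_R_NormedModule)).
  apply (is_RInt_gen_primitive (V := C_R_CompleteNormedModule) _ _ _
    (beta_kernel (a + 1) (a + b) 1) _ _ _ spans_0_oo).
  - intros t Ht; now apply is_derive_beta_kernel.
  - intros t Ht; apply (continuous_plus (V := C_R_NormedModule)).
    + eapply continuous_comp; [apply continuous_beta_kernel; lra | apply filterlim_Cmult].
    + eapply continuous_comp; [apply continuous_beta_kernel; lra | apply filterlim_Cmult].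
  - apply beta_kernel_lim_0; destruct a, b; simpl in *; lra.
  - apply beta_kernel_lim_oo; destruct a, b; simpl in *; lra. }
assert (H1 : is_RInt_gen (V := C_R_NormedModule)
  (fun t => (a - (a + b)) * beta_kernel a (a + b) 1 t + (a + b) * beta_kernel a (a + b + 1) 1 t)%C
  (at_right 0) (Rbar_locally p_infty) ((a - (a + b)) * beta a b + (a + b) * beta a (b + 1))%C).
{ apply (is_RInt_gen_plus (V := C_R_NormedModule)); apply is_RInt_gen_Cmult;
    try typeclasses eauto.
  - now apply is_RInt_gen_beta.
  - rewrite <- Cplus_assoc; apply is_RInt_gen_beta; destruct a, b; simpl in *; lra. }
apply (is_RInt_gen_unique (V := C_R_CompleteNormedModule)) in H0.
apply (is_RInt_gen_unique (V := C_R_CompleteNormedModule)) in H1.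
rewrite H1 in H0.
replace ((a + b) * beta a (b + 1))%C with
  ((a - (a + b)) * beta a b + (a + b) * beta a (b + 1) + b * beta a b)%C by ring.
rewrite H0; ring.
Qed.

(** The boundary case p = a of the same integration by parts: one of the two coefficients is zero,
    and the primitive (t / (1 + t))^a tends to 1 at infinity. *)
Lemma beta_1_r (a : C) : 0 < Re a -> (a * beta a 1)%C = 1.
Proof.
intros Ha.
assert (H0 : is_RInt_gen (V := C_R_NormedModule)
  (fun t => (a - a) * beta_kernel a a 1 t + a * beta_kernel a (a + 1) 1 t)%C
  (at_right 0) (Rbar_locally p_infty) (minus (RtoC 1 : C_R_NormedModule) (RtoC 0))).
{ apply (is_RInt_gen_primitive (V := C_R_CompleteNormedModule) _ _ _
    (beta_kernel (a + 1) a 1) _ _ _ spans_0_oo).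
  - intros t Ht; now apply is_derive_beta_kernel.
  - intros t Ht; apply (continuous_plus (V := C_R_NormedModule)).
    + eapply continuous_comp; [apply continuous_beta_kernel; lra | apply filterlim_Cmult].
    + eapply continuous_comp; [apply continuous_beta_kernel; lra | apply filterlim_Cmult].
  - apply beta_kernel_lim_0; lra.
  - apply filterlim_C_squeeze with (g := fun t => Cmod a * Rpower t (- (1))).
    + exact _.
    + generalize (spans_right _ _ _ spans_0_oo); apply @filter_imp; [exact _|]; intros t Ht.
      assert (Hv : 0 <= ln (1 + 1 * t) - ln t <= / t).
      { assert (Ht' : 0 < / t) by now apply Rinv_0_lt_compat.
        rewrite <- ln_div by lra.
        replace ((1 + 1 * t) / t) with (1 + / t) by (field; lra).
        split; [|apply ln_upper; lra].
        eapply Rle_trans; [|apply ln_lower; lra].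
        apply Rlt_le, Rdiv_lt_0_compat; lra. }
      replace (beta_kernel (a + 1) a 1 t) with (Cexp (- (a * (ln (1 + 1 * t) - ln t)%R))).
      2:{ unfold beta_kernel; f_equal; rewrite RtoC_minus; ring. }
      eapply Rle_trans; [apply Cmod_Cexp_minus_1|].
      * destruct a; simpl in *; rewrite Rmult_0_r, Rminus_0_r; apply Rmult_le_pos; lra.
      * rewrite Cmod_mult, Cmod_R, Rabs_pos_eq, Rpower_Ropp, Rpower_1 by lra.
        apply Rmult_le_compat_l; [apply Cmod_ge_0 | lra].
    + replace 0 with (scal (Cmod a) 0) by (unfold scal; simpl; unfold mult; simpl; ring).
      eapply filterlim_comp; [apply Rpower_lim_oo; lra|].
      apply (filterlim_scal_r (V := R_NormedModule)). }
assert (H1 : is_RInt_gen (V := C_R_NormedModule)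
  (fun t => (a - a) * beta_kernel a a 1 t + a * beta_kernel a (a + 1) 1 t)%C
  (at_right 0) (Rbar_locally p_infty) (a * beta a 1)%C).
{ apply (is_RInt_gen_ext_on (V := C_R_NormedModule) _ _ _
    (fun t => a * beta_kernel a (a + 1) 1 t)%C _ _ spans_0_oo).
  - intros t _; refine (_ : @eq C _ _); ring.
  - apply is_RInt_gen_Cmult; try typeclasses eauto.
    apply is_RInt_gen_beta; simpl; lra. }
apply (is_RInt_gen_unique (V := C_R_CompleteNormedModule)) in H0.
apply (is_RInt_gen_unique (V := C_R_CompleteNormedModule)) in H1.
rewrite <- H1, H0.
change (1 - 0 = 1)%C; ring.
Qed.

Lemma Re_INR_plus (b : C) (n : nat) : 0 < Re b -> 0 < Re (b + INR n).
Proof. intros Hb; pose proof (pos_INR n); destruct b; simpl in *; lra. Qed.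

Lemma INR_C_S (n : nat) : RtoC (INR (S n)) = (INR n + 1)%C.
Proof. now rewrite S_INR, RtoC_plus. Qed.

(* Multiplied by n^(a+b), this becomes B(a,b) Gamma(a+b) = Gamma(a) Gamma(b) as
   n tends to infinity. *)
Lemma beta_cocycle (a b : C) (n : nat) : 0 < Re a -> 0 < Re b ->
  (beta a (b + 1 + INR n) * beta b (1 + INR n) = beta a b * beta (a + b) (1 + INR n))%C.
Proof.
intros Ha Hb.
assert (Hab : 0 < Re (a + b)) by (destruct a, b; simpl in *; lra).
assert (Hb1 : 0 < Re (b + 1)) by (destruct b; simpl in *; lra).
assert (H1 : 0 < Re 1) by (simpl; lra).
induction n as [|n IH].
- simpl; rewrite !Cplus_0_r.
  pose proof (beta_1_r b Hb) as E1; pose proof (beta_1_r _ Hab) as E2.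
  pose proof (beta_recurrence a b Ha Hb) as E3.
  replace (beta b 1) with (beta b 1 * ((a + b) * beta (a + b) 1))%C by (rewrite E2; ring).
  replace (beta a (b + 1) * (beta b 1 * ((a + b) * beta (a + b) 1)))%C with
    (((a + b) * beta a (b + 1)) * beta b 1 * beta (a + b) 1)%C by ring.
  rewrite E3; transitivity ((b * beta b 1) * beta a b * beta (a + b) 1)%C; [ring|].
  rewrite E1; ring.
- rewrite !INR_C_S, !Cplus_assoc.
  pose proof (Re_INR_plus _ n H1) as P1; pose proof (Re_INR_plus _ n Hb1) as P2.
  assert (P3 : 0 < Re (b + (1 + INR n))) by (rewrite Cplus_assoc; exact P2).
  assert (P4 : 0 < Re (a + b + (1 + INR n))) by (destruct a, b; simpl in *; lra).
  pose proof (beta_recurrence a _ Ha P2) as E1.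
  pose proof (beta_recurrence b _ Hb P1) as E2.
  pose proof (beta_recurrence (a + b) _ Hab P1) as E3.
  apply Cneq_0_Re in P3; apply Cneq_0_Re in P4.
  set (N := (1 + INR n)%C) in *.
  replace (b + 1 + INR n)%C with (b + N)%C in * by (unfold N; ring).
  replace (a + (b + N))%C with (a + b + N)%C in E1 by ring.
  set (x1 := beta a (b + N + 1)) in *; set (x2 := beta b (N + 1)) in *.
  set (x3 := beta (a + b) (N + 1)) in *.
  set (y1 := beta a (b + N)) in *; set (y2 := beta b N) in *; set (y3 := beta (a + b) N) in *.
  (* One step multiplies the left side by (b + N) / (a + b + N) and N / (b + N), the right side by N
     / (a + b + N): the same factor. *)
  replace x1 with ((b + N) * y1 / (a + b + N))%C by (rewrite <- E1; field; trivial).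
  replace x2 with (N * y2 / (b + N))%C by (rewrite <- E2; field; trivial).
  replace x3 with (N * y3 / (a + b + N))%C by (rewrite <- E3; field; trivial).
  transitivity (N * (y1 * y2) / (a + b + N))%C; [field; auto|].
  rewrite IH; field; trivial.
Qed.

(** Limits in the real module C use product neighbourhoods, while multiplication is continuous for
    the modulus; [locally_C] passes between the two. *)
Lemma filterlim_Cmult2 {T : Type} (F : (T -> Prop) -> Prop) {FF : Filter F}
  (f g : T -> C) (x y : C) :
  filterlim (U := C_R_NormedModule) f F (locally (x : C_R_NormedModule)) ->
  filterlim (U := C_R_NormedModule) g F (locally (y : C_R_NormedModule)) ->
  filterlim (U := C_R_NormedModule) (fun t => f t * g t)%C F
    (locally ((x * y)%C : C_R_NormedModule)).
Proof.
intros Hf Hg P HP.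
apply (filterlim_comp_2 f g (fun u v => u * v)%C (F := F)
  (G := locally (x : AbsRing_UniformSpace C_AbsRing))
  (H := locally (y : AbsRing_UniformSpace C_AbsRing))
  (I := locally ((x * y)%C : AbsRing_UniformSpace C_AbsRing))).
- intros Q HQ; apply Hf, locally_C, HQ.
- intros Q HQ; apply Hg, locally_C, HQ.
- apply (filterlim_mult (K := C_AbsRing) x y).
- apply locally_C, HP.
Qed.

Theorem beta_Gamma_integral (a b : C) : 0 < Re a -> 0 < Re b ->
  (beta a b * Gamma_integral (a + b) = Gamma_integral a * Gamma_integral b)%C.
Proof.
intros Ha Hb.
assert (Hab : 0 < Re (a + b)) by (destruct a, b; simpl in *; lra).
assert (Hb1 : 0 < Re (b + 1)) by (destruct b; simpl in *; lra).
assert (H1 : 0 < Re 1) by (simpl; lra).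
pose proof (filterlim_Cmult2 eventually _ _ _ _
  (gamma_limit a _ Ha Hb1) (gamma_limit b 1 Hb H1)) as L1.
pose proof (filterlim_comp _ _ _ _ _ _ _ _ (gamma_limit (a + b) 1 Hab H1)
  (filterlim_Cmult (beta a b) _)) as L2.
apply (filterlim_locally_unique (F := eventually) (V := C_R_NormedModule) _ _ _ L2).
(* The index 0 is left out: n^(a+b) = n^a n^b is used for a positive base. *)
revert L1; apply filterlim_ext_loc; exists 1%nat; intros n Hn.
assert (Hn' : 0 < INR n) by (apply lt_0_INR; lia).
rewrite Cpower_plus by easy.
pose proof (beta_cocycle a b n Ha Hb) as E.
transitivity (Cpower (INR n) a * Cpower (INR n) b *
  (beta a (b + 1 + INR n) * beta b (1 + INR n)))%C; [refine (_ : @eq C _ _); ring|].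
rewrite E; refine (_ : @eq C _ _); ring.
Qed.

(** * The Gamma function *)

Lemma Gamma_integral_1 : Gamma_integral 1 = 1.
Proof.
assert (HG : is_RInt_gen (V := C_R_NormedModule) (fun t => - (1) * gamma_kernel 1 t)%C
  (at_right 0) (Rbar_locally p_infty) (minus (RtoC 0 : C_R_NormedModule) (RtoC 1))).
{ apply (is_RInt_gen_primitive (V := C_R_CompleteNormedModule) _ _ _
    (gamma_kernel 1) _ _ _ spans_0_oo).
  - intros t Ht.
    replace (- (1) * gamma_kernel 1 t)%C
      with (((1 - 1) * RtoC (/ t) + - (1) * 1) * gamma_kernel 1 t)%C by ring.
    apply (is_derive_Cexp (1 - 1) (- (1)) ln (fun t => t)).
    + now apply is_derive_ln.
    + auto_derive; trivial.
  - intros t Ht; eapply continuous_comp; [now apply continuous_gamma_kernel |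
       apply filterlim_Cmult].
  - apply filterlim_C_squeeze with (g := fun t => t).
    + exact _.
    + generalize (spans_left _ _ _ spans_0_oo); apply @filter_imp; [exact _|]; intros t Ht.
      replace (gamma_kernel 1 t) with (Cexp (- RtoC t)) by (unfold gamma_kernel; f_equal; ring).
      eapply Rle_trans; [apply Cmod_Cexp_minus_1; simpl; lra|].
      rewrite Cmod_R, Rabs_pos_eq; lra.
    + intros P [e He]; exists e; intros y Hy _; now apply He.
  - apply filterlim_C_squeeze with (g := fun t => Rpower t (- (1))).
    + exact _.
    + generalize (spans_right _ _ _ spans_0_oo); apply @filter_imp; [exact _|]; intros t Ht.
      rewrite Cminus_0_r, Cmod_gamma_kernel, Rpower_Ropp, Rpower_1 by easy; simpl.
      rewrite Rminus_diag, Rpower_O, Rmult_1_l, exp_Ropp by easy.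
      apply Rinv_le_contravar; [easy|]; pose proof (exp_ineq1_le t); lra.
    + apply Rpower_lim_oo; lra. }
assert (H1 : 0 < Re 1) by (simpl; lra).
pose proof (is_RInt_gen_Cmult _ _ (- (1)) _ _ (is_RInt_gen_Gamma 1 H1)) as H2.
apply (is_RInt_gen_unique (V := C_R_CompleteNormedModule)) in HG.
apply (is_RInt_gen_unique (V := C_R_CompleteNormedModule)) in H2.
rewrite H2 in HG.
transitivity (- (- (1) * Gamma_integral 1))%C; [ring|].
rewrite HG; change (- (0 - 1) = 1)%C; ring.
Qed.

(** The case b = 1 of the Beta relation, as B(a, 1) = 1 / a and the integral at 1 is 1. *)
Lemma Gamma_integral_S (a : C) : 0 < Re a ->
  Gamma_integral (a + 1) = (a * Gamma_integral a)%C.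
Proof.
intros Ha; assert (H1 : 0 < Re 1) by (simpl; lra).
pose proof (beta_Gamma_integral a 1 Ha H1) as E.
rewrite Gamma_integral_1 in E; pose proof (beta_1_r a Ha) as E1.
transitivity ((a * beta a 1) * Gamma_integral (a + 1))%C; [rewrite E1; ring|].
rewrite <- Cmult_assoc, E; ring.
Qed.

(** The integrand is positive, so every integral over a segment containing [1, 2] is at least the
    fixed positive integral over [1, 2]; a zero limit would make some of them smaller. *)
Lemma Gamma_integral_neq_0 (x : R) : 0 < x -> Gamma_integral x <> 0.
Proof.
intros Hx E.
set (r := fun t => Rpower t (x - 1) * exp (- t)).
assert (Hg : forall t, gamma_kernel x t = RtoC (r t)).
{ intros t; unfold gamma_kernel, r, Rpower; rewrite <- exp_plus, <- Cexp_RtoC; f_equal.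
  apply injective_projections; simpl; ring. }
assert (Hr : forall t, 0 < r t) by (intros; apply Rmult_lt_0_compat; apply exp_pos).
assert (Hc : forall t, 0 < t -> continuous r t).
{ intros t Ht; apply (ex_derive_continuous (V := R_NormedModule)).
  apply ex_derive_mult; [eexists; now apply is_derive_Rpower | auto_derive; trivial]. }
assert (He : forall a b, 0 < a -> 0 < b -> ex_RInt r a b).
{ intros a b Ha Hb; apply @ex_RInt_continuous; intros z Hz; apply Hc.
  eapply Rlt_le_trans; [|apply Hz]; now apply Rmin_glb_lt. }
assert (Hm : 0 < RInt r 1 2).
{ apply RInt_gt_0; [lra | auto | intros; apply Hc; lra]. }
pose proof (is_RInt_gen_Gamma x Hx) as HG; rewrite E in HG.
destruct (HG (fun z : C => Rabs (fst z) < RInt r 1 2)) as [Q S HQ HS HQS].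
{ exists (mkposreal _ Hm); intros [u v] [Hu _]; simpl in *.
  change (Rabs (u - 0) < RInt r 1 2) in Hu; rewrite Rminus_0_r in Hu; exact Hu. }
assert (HQ' : at_right 0 (fun t => 0 < t < 1)).
{ exists (mkposreal 1 Rlt_0_1); intros y Hy Hy'; change (Rabs (y - 0) < 1) in Hy.
  apply Rabs_lt_between in Hy; lra. }
destruct (filter_ex _ (filter_and _ _ HQ HQ')) as [a [Qa Ha]].
assert (HS' : Rbar_locally p_infty (fun t => 2 < t)) by (exists 2; trivial).
destruct (filter_ex _ (filter_and _ _ HS HS')) as [b [Sb Hb]].
destruct (HQS a b Qa Sb) as [y [Hy Py]]; simpl in Hy, Py.
apply (is_RInt_fct_extend_fst (U := R_NormedModule) (V := R_NormedModule)) in Hy.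
apply (is_RInt_ext _ r) in Hy; [|intros t _; now rewrite Hg].
apply (is_RInt_unique (V := R_CompleteNormedModule) r a b) in Hy.
change (RInt r a b = @fst R R y) in Hy; rewrite <- Hy in Py.
rewrite <- (RInt_Chasles r a 1 b), <- (RInt_Chasles r 1 2 b) in Py by (apply He; lra).
unfold plus in Py; simpl in Py.
assert (0 <= RInt r a 1).
{ apply RInt_ge_0; [lra | apply He; lra | intros; apply Rlt_le, Hr]. }
assert (0 <= RInt r 2 b).
{ apply RInt_ge_0; [lra | apply He; lra | intros; apply Rlt_le, Hr]. }
rewrite Rabs_pos_eq in Py; lra.
Qed.

Lemma Gamma_Re_pos (z : C) : 0 < Re z -> Gamma z = Gamma_integral z.
Proof.
intros Hz; unfold Gamma.
replace (Gamma_shift z) with 0%nat.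
- simpl; rewrite Cplus_0_r; field; apply Cneq_0_Re; simpl; lra.
(* [up (- Re z)] is the least integer strictly above - Re z; here it is at most 0, and [Z.to_nat]
   sends it to 0. *)
- unfold Gamma_shift; destruct (archimed (- Re z)) as [_ H].
  assert (IZR (up (- Re z)) < 1) as H' by lra.
  apply lt_IZR in H'; destruct (up (- Re z)); trivial; lia.
Qed.

Lemma Gamma_Re_neg (z : C) : -1 < Re z <= 0 -> Gamma z = (Gamma_integral (z + 1) / z)%C.
Proof.
intros Hz; unfold Gamma.
replace (Gamma_shift z) with 1%nat.
- simpl; rewrite Cplus_0_r, Cmult_1_l; reflexivity.
- unfold Gamma_shift; destruct (archimed (- Re z)) as [H1 H2].
  assert (IZR (up (- Re z)) < 2) as H2' by lra; assert (0 < IZR (up (- Re z))) as H1' by lra.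
  apply lt_IZR in H2'; apply lt_IZR in H1'.
  now replace (up (- Re z)) with 1%Z by lia.
Qed.

Lemma Gamma_S (z : C) : -1 < Re z -> z <> 0 -> Gamma (z + 1) = (z * Gamma z)%C.
Proof.
intros Hz Hz0; rewrite (Gamma_Re_pos (z + 1)) by (destruct z; simpl in *; lra).
destruct (Rle_dec (Re z) 0).
- rewrite Gamma_Re_neg by lra; field; trivial.
- rewrite Gamma_Re_pos by lra; apply Gamma_integral_S; lra.
Qed.

(** Substitution t = s / (1 - s), for which 1 + t = 1 / (1 - s) and dt = ds / (1 - s)^2. *)
Lemma is_RInt_gen_beta_0_1 (a b : C) : 0 < Re a -> 0 < Re b ->
  is_RInt_gen (V := C_R_NormedModule)
    (fun s => Cpower s (a - 1) * Cpower (1 - s)%R (b - 1))%C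
    (at_right 0) (at_left 1) (beta a b).
Proof.
intros Ha Hb.
apply (is_RInt_gen_ext_on (V := C_R_NormedModule) _ _ _
  (fun s => RtoC (/ (1 - s) ^ 2) * beta_kernel a (a + b) 1 (s / (1 - s)))%C _ _ spans_0_1).
{ intros s Hs; rewrite !Cpower_pos by lra.
  replace (RtoC (/ (1 - s) ^ 2)) with (Cexp (- RtoC (2 * ln (1 - s)))).
  2:{ rewrite <- RtoC_opp, Cexp_RtoC, exp_Ropp; do 2 f_equal.
    replace (2 * ln (1 - s)) with (ln (1 - s) + ln (1 - s)) by ring.
    rewrite exp_plus, exp_ln by lra; ring. }
  unfold beta_kernel; rewrite <- !Cexp_plus.
  replace (1 + 1 * (s / (1 - s))) with (/ (1 - s)) by (field; lra).
  rewrite ln_div, ln_Rinv by lra.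
  rewrite RtoC_minus, RtoC_mult, RtoC_opp.
  f_equal; ring. }
apply (is_RInt_gen_comp_C _ _ _ (at_right 0) (Rbar_locally p_infty)
  (beta_kernel a (a + b) 1) (fun s => s / (1 - s)) (fun s => / (1 - s) ^ 2) _ spans_0_1).
- intros s Hs; apply continuous_beta_kernel; [lra | apply Rdiv_lt_0_compat; lra].
- intros s Hs; split.
  + auto_derive; [lra | field; lra].
  + apply (ex_derive_continuous (V := R_NormedModule)); auto_derive.
    apply Rmult_integral_contrapositive_currified; lra.
- intros P [e He].
  assert (Hl : filterlim (fun s => s / (1 - s)) (locally 0) (locally 0)).
  { replace 0 with ((fun s => s / (1 - s)) 0) at 2 by (field; lra).
    apply (ex_derive_continuous (V := R_NormedModule) (fun s => s / (1 - s))); auto_derive; lra. }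
  assert (H : locally 0 (fun s => ball 0 e (s / (1 - s)))) by exact (Hl _ (locally_ball 0 e)).
  generalize (filter_and (F := at_right 0) _ _ (filter_le_within _ _ H)
    (spans_left _ _ _ spans_0_1)).
  unfold filtermap; apply filter_imp; intros s [H1 H2].
  apply He; [exact H1 | apply Rdiv_lt_0_compat; lra].
- intros P [M HM].
  set (K := Rmax M 0 + 1); assert (HK : 0 < K /\ M < K).
  { unfold K; pose proof (Rmax_l M 0); pose proof (Rmax_r M 0); lra. }
  assert (H : at_left 1 (fun s => 1 - s < / (K + 1))).
  { exists (mkposreal (/ (K + 1)) (Rinv_0_lt_compat _ (Rplus_lt_0_compat _ _ (proj1 HK) Rlt_0_1)));
    intros y Hy Hy'.
    change (Rabs (y - 1) < / (K + 1)) in Hy; apply Rabs_lt_between in Hy; lra. }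
  generalize (filter_and _ _ H (spans_right _ _ _ spans_0_1)).
  unfold filtermap; apply filter_imp; intros s [H1 H2]; apply HM.
  apply Rlt_trans with K; [lra|].
  assert (H3 : K + 1 < / (1 - s)).
  { rewrite <- (Rinv_inv (K + 1)); apply Rinv_lt_contravar; trivial.
    apply Rmult_lt_0_compat; [lra | apply Rinv_0_lt_compat; lra]. }
  replace (s / (1 - s)) with (/ (1 - s) - 1) by (field; lra); lra.
- now apply is_RInt_gen_beta.
Qed.

(** * Finite differences and binomial sums *)

(** [sum_n] rewritten with the addition of C itself, so that [simpl] and [ring] act on it. *)
Fixpoint Csum (f : nat -> C) (n : nat) : C :=
  match n with
  | O => f O
  | S k => (Csum f k + f (S k))%C
  end.

Lemma sum_n_Csum (f : nat -> C) (n : nat) : sum_n f n = Csum f n.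
Proof.
induction n as [|n IH]; [exact (sum_O f)|].
simpl; rewrite <- IH; exact (sum_Sn f n).
Qed.

Lemma Csum_S (f : nat -> C) (n : nat) : Csum f (S n) = (Csum f n + f (S n))%C.
Proof. reflexivity. Qed.

Lemma Csum_ext (f g : nat -> C) (n : nat) :
  (forall k, (k <= n)%nat -> f k = g k) -> Csum f n = Csum g n.
Proof.
induction n as [|n IH]; intros H; simpl; [auto|].
rewrite IH, H; auto.
Qed.

Lemma Csum_plus (f g : nat -> C) (n : nat) :
  Csum (fun k => f k + g k)%C n = (Csum f n + Csum g n)%C.
Proof. induction n as [|n IH]; simpl; [|rewrite IH]; ring. Qed.

Lemma Csum_mult_l (c : C) (f : nat -> C) (n : nat) :
  Csum (fun k => c * f k)%C n = (c * Csum f n)%C.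
Proof. induction n as [|n IH]; simpl; [|rewrite IH]; ring. Qed.

Lemma Csum_mult (f g : nat -> C) (m n : nat) :
  (Csum f m * Csum g n)%C = Csum (fun l => Csum (fun k => f l * g k)%C n) m.
Proof.
induction m as [|m IH]; simpl; rewrite Csum_mult_l; trivial.
rewrite <- IH; ring.
Qed.

Lemma Csum_shift (f : nat -> C) (n : nat) :
  Csum f (S n) = (f O + Csum (fun k => f (S k)) n)%C.
Proof.
induction n as [|n IH]; [reflexivity|].
change (Csum f (S (S n))) with (Csum f (S n) + f (S (S n)))%C.
rewrite IH; simpl; ring.
Qed.

Lemma is_RInt_gen_Csum F G {FF : Filter F} {FG : Filter G}
  (f : nat -> R -> C) (l : nat -> C) (n : nat) :
  (forall k, (k <= n)%nat -> is_RInt_gen (V := C_R_NormedModule) (f k) F G (l k)) ->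
  is_RInt_gen (V := C_R_NormedModule) (fun t => Csum (fun k => f k t) n) F G (Csum l n).
Proof.
induction n as [|n IH]; intros H; simpl; [now apply H|].
apply (is_RInt_gen_plus (V := C_R_NormedModule) (fun t => Csum (fun k => f k t) n)); auto.
Qed.

(** The Pochhammer symbol (z)_n, equal to Gamma (z + n) / Gamma z away from the poles. *)
Definition poch (z : C) (n : nat) : C := Cprod (fun k => z + INR k)%C n.

Lemma poch_add (z : C) (m n : nat) : poch z (m + n) = (poch z m * poch (z + INR m) n)%C.
Proof.
induction n as [|n IH]; [rewrite Nat.add_0_r; unfold poch at 3; simpl; ring|].
rewrite Nat.add_succ_r; unfold poch in *; simpl; rewrite IH, plus_INR, RtoC_plus; ring.
Qed.

(** The falling product is made of the top j factors z + n - 1, ..., z + n - j of (z)_n. *)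
Lemma falling_poch (z : C) (n j : nat) : (j <= n)%nat ->
  (Cprod (fun i => INR n + (z - 1) - INR i)%C j * poch z (n - j))%C = poch z n.
Proof.
induction j as [|j IH]; intros Hj; [rewrite Nat.sub_0_r; simpl; ring|].
rewrite <- IH by lia.
replace (n - j)%nat with (S (n - S j)) by lia.
unfold poch; simpl Cprod.
rewrite (minus_INR n (S j)), S_INR, RtoC_minus, RtoC_plus by lia; ring.
Qed.

Lemma INR_fact_C_neq_0 (n : nat) : RtoC (INR (fact n)) <> 0.
Proof. intros H; apply (INR_fact_neq_0 n); now apply RtoC_inj. Qed.

Lemma INR_S_C_neq_0 (n : nat) : RtoC (INR (S n)) <> 0.
Proof. intros H; apply (not_0_INR (S n)); [lia | now apply RtoC_inj]. Qed.

Lemma fact_S_C (n : nat) : RtoC (INR (fact (S n))) = (INR (S n) * INR (fact n))%C.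
Proof. now rewrite fact_simpl, mult_INR, RtoC_mult. Qed.

Lemma Cbinom_poch (z : C) (n j : nat) : (j <= n)%nat ->
  (Cbinom (INR n + (z - 1)) j * poch z (n - j))%C = (poch z n / INR (fact j))%C.
Proof.
intros Hj; rewrite <- (falling_poch z n j Hj); unfold Cbinom; field.
apply INR_fact_C_neq_0.
Qed.

Lemma Cbinom_S (x : C) (k : nat) :
  (INR (S k) * Cbinom x (S k) = (x - INR k) * Cbinom x k)%C.
Proof.
unfold Cbinom; rewrite fact_S_C; simpl Cprod; field.
split; first [apply INR_fact_C_neq_0 | apply INR_S_C_neq_0].
Qed.

(** Induction after multiplying by n + 1 = (n + 1 - l) + l: absorption lowers one of the two lower
    indices, and the factors x - (n - l) and y - l add up to x + y - n. *)
Lemma Cbinom_Vandermonde (x y : C) (n : nat) :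
  Csum (fun l => Cbinom x (n - l) * Cbinom y l)%C n = Cbinom (x + y) n.
Proof.
induction n as [|n IH]; [unfold Cbinom; simpl; field; apply Cneq_0_Re; simpl; lra|].
assert (H : (INR (S n) * Csum (fun l => Cbinom x (S n - l) * Cbinom y l) (S n) =
  INR (S n) * Cbinom (x + y) (S n))%C).
{ rewrite Cbinom_S, <- IH, <- !Csum_mult_l.
  transitivity (Csum (fun l => INR (S n - l) * Cbinom x (S n - l) * Cbinom y l
     + Cbinom x (S n - l) * (INR l * Cbinom y l)) (S n))%C.
  { apply Csum_ext; intros l Hl; rewrite (minus_INR (S n) l), RtoC_minus by easy; ring. }
  rewrite Csum_plus, (Csum_S _ n), Csum_shift.
  rewrite Nat.sub_diag; simpl (INR 0).
  transitivity (Csum (fun l => INR (S n - l) * Cbinom x (S n - l) * Cbinom y l) n +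
    Csum (fun l => Cbinom x (S n - S l) * (INR (S l) * Cbinom y (S l))) n)%C; [simpl; ring|].
  rewrite <- Csum_plus; apply Csum_ext; intros l Hl.
  rewrite Cbinom_S; replace (S n - l)%nat with (S (n - l)) by lia.
  rewrite Cbinom_S, (minus_INR n l), RtoC_minus by easy; simpl (S n - S l)%nat; ring. }
transitivity (INR (S n) * Csum (fun l => Cbinom x (S n - l) * Cbinom y l) (S n) / INR (S n))%C.
- field; apply INR_S_C_neq_0.
- rewrite H; field; apply INR_S_C_neq_0.
Qed.

(* (1/n!) times the n-th power of [1 - shift] applied to f, evaluated at 0. *)
Definition fdiff (n : nat) (f : nat -> C) : C :=
  Csum (fun k => (-1) ^ k / (INR (fact k) * INR (fact (n - k))) * f k)%C n.

Lemma fdiff_ext (n : nat) (f g : nat -> C) :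
  (forall k, (k <= n)%nat -> f k = g k) -> fdiff n f = fdiff n g.
Proof. intros H; apply Csum_ext; intros k Hk; now rewrite H. Qed.

Lemma fdiff_linear (n : nat) (x y : C) (f g : nat -> C) :
  fdiff n (fun k => x * f k + y * g k)%C = (x * fdiff n f + y * fdiff n g)%C.
Proof.
unfold fdiff; rewrite <- !Csum_mult_l, <- Csum_plus; apply Csum_ext; intros; ring.
Qed.

(** The factor k kills the term k = 0 and turns 1 / k! into 1 / (k - 1)!; the shift of index
    accounts for the sign. *)
Lemma fdiff_mult_index (n : nat) (f : nat -> C) :
  fdiff (S n) (fun k => INR k * f k)%C = (- fdiff n (fun k => f (S k)))%C.
Proof.
unfold fdiff; rewrite Csum_shift; simpl (INR 0).
transitivity (-1 * Csum (fun k => (-1) ^ k / (INR (fact k) * INR (fact (n - k))) * f (S k)) n)%C;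
  [|ring].
rewrite <- Csum_mult_l, Cmult_0_l, Cmult_0_r, Cplus_0_l; apply Csum_ext; intros k Hk.
rewrite fact_S_C; simpl (S n - S k)%nat; simpl Cpow; field.
repeat split; first [apply INR_fact_C_neq_0 | apply INR_S_C_neq_0].
Qed.

Lemma fdiff_1 (n : nat) : fdiff n (fun _ => 1) = if Nat.eq_dec n 0 then 1 else 0.
Proof.
destruct n as [|n]; simpl.
{ unfold fdiff; simpl; field; apply Cneq_0_Re; simpl; lra. }
assert (H : (INR (S n) * fdiff (S n) (fun _ => 1))%C = 0).
(* Splitting n + 1 = k + (n + 1 - k) yields one sum with the factor k and one of order n; by
   [fdiff_mult_index] they are opposite. *)
{ transitivity (fdiff (S n) (fun k => INR k * 1)%C + fdiff n (fun _ => 1))%C.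
  - unfold fdiff; rewrite !(Csum_S _ n).
    rewrite Cmult_plus_distr_l, <- Csum_mult_l.
    transitivity (Csum (fun k => (-1) ^ k / (INR (fact k) * INR (fact (S n - k))) * (INR k * 1)
      + (-1) ^ k / (INR (fact k) * INR (fact (n - k))) * 1) n +
      INR (S n) * ((-1) ^ S n / (INR (fact (S n)) * INR (fact (S n - S n))) * 1))%C.
    + f_equal; apply Csum_ext; intros k Hk.
      replace (S n - k)%nat with (S (n - k)) by lia; rewrite fact_S_C.
      replace (RtoC (INR (S n))) with (INR k + INR (S (n - k)))%C
        by (rewrite <- RtoC_plus, <- plus_INR; do 2 f_equal; lia).
      field; repeat split; first [apply INR_fact_C_neq_0 | apply INR_S_C_neq_0].
    + rewrite Csum_plus; ring.
  - rewrite fdiff_mult_index; ring. }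
transitivity (INR (S n) * fdiff (S n) (fun _ => 1) / INR (S n))%C.
- field; apply INR_S_C_neq_0.
- rewrite H; field; apply INR_S_C_neq_0.
Qed.

(* p behaves under finite differences as a polynomial of degree at most d with
   coefficient c of x^d; the translations x0 make the induction on d work. *)
Definition poly_like (d : nat) (c : C) (p : C -> C) : Prop := forall x0 : C,
  (forall n, (d < n)%nat -> fdiff n (fun k => p (INR k + x0)%C) = 0)
  /\ fdiff d (fun k => p (INR k + x0)%C) = ((-1) ^ d * c)%C.

Lemma poly_like_1 : poly_like 0 1 (fun _ => 1).
Proof.
intros x0; split.
- intros n Hn; rewrite fdiff_1; destruct n; [lia | reflexivity].
- rewrite fdiff_1; simpl; ring.
Qed.

Lemma poly_like_ext (d : nat) (c c' : C) (p q : C -> C) :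
  c = c' -> (forall x, p x = q x) -> poly_like d c p -> poly_like d c' q.
Proof.
intros <- H Hp x0; destruct (Hp x0) as [H1 H2]; split.
- intros n Hn; rewrite <- (H1 n Hn); apply fdiff_ext; auto.
- rewrite <- H2; apply fdiff_ext; auto.
Qed.

(** In e (k + x0) + h = e k + (e x0 + h), the part e k lowers the order by one and moves x0 to x0 +
    1, which is why all translations are carried along. *)
Lemma poly_like_mult (d : nat) (c e h : C) (p : C -> C) :
  poly_like d c p -> poly_like (S d) (c * e) (fun x => p x * (e * x + h))%C.
Proof.
intros Hp x0.
assert (E : forall n, fdiff (S n) (fun k => p (INR k + x0) * (e * (INR k + x0) + h))%C =
  (e * (- fdiff n (fun k => p (INR k + (x0 + 1)))) +
   (e * x0 + h) * fdiff (S n) (fun k => p (INR k + x0)))%C).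
{ intros n; transitivity (fdiff (S n) (fun k => e * (INR k * p (INR k + x0)) +
    (e * x0 + h) * p (INR k + x0))%C).
  - apply fdiff_ext; intros; ring.
  - rewrite fdiff_linear, fdiff_mult_index; do 3 f_equal; apply fdiff_ext.
    intros k _; rewrite INR_C_S; f_equal; ring. }
destruct (Hp x0) as [H1 _]; destruct (Hp (x0 + 1)%C) as [H2 H3]; split.
- intros [|n] Hn; [lia|]; rewrite E, H1, H2 by lia; ring.
- rewrite E, H1, H3 by lia; simpl; ring.
Qed.

Lemma poly_like_poch (d : nat) (c a e : C) (p : C -> C) (l : nat) : poly_like d c p ->
  poly_like (d + l) (c * e ^ l) (fun x => p x * poch (a + e * x) l)%C.
Proof.
intros Hp; induction l as [|l IH].
- rewrite Nat.add_0_r; revert Hp; apply poly_like_ext; intros; unfold poch; simpl; ring.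
- rewrite Nat.add_succ_r; generalize (poly_like_mult _ _ e (a + INR l)%C _ IH).
  apply poly_like_ext; intros; unfold poch; simpl; ring.
Qed.

(** As a function of k the product has degree l + (m - l) = m and leading coefficient (-1)^(m-l),
    since k enters n - k with a minus sign; for m = n the difference contributes (-1)^m, leaving
    (-1)^l. *)
Lemma fdiff_poch (a b : C) (n m l : nat) : (l <= m <= n)%nat ->
  fdiff n (fun k => poch (a + INR k) l * poch (b + INR (n - k)) (m - l))%C =
  if Nat.eq_dec m n then ((-1) ^ l)%C else 0%C.
Proof.
intros H.
pose proof (poly_like_poch _ _ (b + INR n) (-1) _ (m - l)
  (poly_like_poch _ _ a 1 _ l poly_like_1) 0) as [H1 H2].
replace (0 + l + (m - l))%nat with m in * by lia.
transitivity (fdiff n (fun k => 1 * poch (a + 1 * (INR k + 0)) l *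
  poch (b + INR n + -1 * (INR k + 0)) (m - l))%C).
{ apply fdiff_ext; intros k Hk; rewrite Cmult_1_l; f_equal; f_equal; [ring|].
  rewrite minus_INR, RtoC_minus by easy; ring. }
destruct (Nat.eq_dec m n) as [<-|Hn]; [|apply H1; lia].
rewrite H2; clear H1 H2; replace m with (l + (m - l))%nat at 1 by lia.
rewrite Cpow_add_r, !Cpow_1_l.
transitivity ((-1) ^ l * ((-1) ^ (m - l) * (-1) ^ (m - l)))%C; [ring|].
rewrite <- Cpow_mult_l; replace (-1 * -1)%C with (RtoC 1) by ring.
rewrite Cpow_1_l; ring.
Qed.

(** * Jacobi and Romanovski polynomials *)

Lemma RtoC_2 : RtoC 2 = (1 + 1)%C.
Proof. now rewrite <- RtoC_plus. Qed.

Lemma Gamma_poch (z : C) (n : nat) : -1 < Re z -> z <> 0 ->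
  Gamma (z + INR n) = (poch z n * Gamma z)%C.
Proof.
intros Hz Hz0; induction n as [|n IH].
- unfold poch; simpl; rewrite Cplus_0_r; ring.
- rewrite INR_C_S, Cplus_assoc, Gamma_S, IH.
  + unfold poch; simpl; ring.
  + pose proof (pos_INR n); destruct z; simpl in *; lra.
  + destruct n; [now rewrite Cplus_0_r|].
    apply Cneq_0_Re; rewrite INR_C_S; pose proof (pos_INR n); destruct z; simpl in *; lra.
Qed.

Lemma Gamma_INR_S (n : nat) : Gamma (INR n + 1) = INR (fact n).
Proof.
rewrite Cplus_comm, Gamma_poch by (simpl; lra || (apply Cneq_0_Re; simpl; lra)).
rewrite Gamma_Re_pos, Gamma_integral_1, Cmult_1_r by (simpl; lra).
induction n as [|n IH]; [reflexivity|].
rewrite fact_S_C, <- IH; unfold poch; simpl Cprod; rewrite INR_C_S; ring.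
Qed.

Lemma Gamma_neq_0 (x : R) : 0 < x -> Gamma x <> 0.
Proof. intros Hx; rewrite Gamma_Re_pos by easy; now apply Gamma_integral_neq_0. Qed.

Lemma beta_poch (a b : C) (i j : nat) : 0 < Re a -> 0 < Re b ->
  Gamma (a + b + INR (i + j)) <> 0 ->
  beta (a + INR i) (b + INR j) =
  (poch a i * poch b j * (Gamma a * Gamma b / Gamma (a + b + INR (i + j))))%C.
Proof.
intros Ha Hb HD.
pose proof (Re_INR_plus a i Ha) as Ha'; pose proof (Re_INR_plus b j Hb) as Hb'.
pose proof (beta_Gamma_integral _ _ Ha' Hb') as E.
replace (a + INR i + (b + INR j))%C with (a + b + INR (i + j))%C in E
  by (rewrite plus_INR, RtoC_plus; ring).
assert (Hab : 0 < Re (a + b)) by (destruct a, b; simpl in *; lra).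
rewrite <- (Gamma_Re_pos _ Ha'), <- (Gamma_Re_pos _ Hb') in E.
rewrite <- (Gamma_Re_pos _ (Re_INR_plus _ (i + j) Hab)) in E.
rewrite (Gamma_poch a), (Gamma_poch b) in E by (lra || now apply Cneq_0_Re).
transitivity (beta (a + INR i) (b + INR j) * Gamma (a + b + INR (i + j)) /
  Gamma (a + b + INR (i + j)))%C; [field; trivial|].
rewrite E; field; trivial.
Qed.

(* The coefficients in the basis s^k (1-s)^(n-k), where x = 1 - 2 s. *)
Definition jacobi_coef (a b : C) (n k : nat) : C :=
  (Cbinom (INR n + (a - 1)) (n - k) * Cbinom (INR n + (b - 1)) k * (-1) ^ k)%C.

Lemma jacobi_jacobi_coef (a b s : C) (n : nat) :
  jacobi (a - 1) (b - 1) n (1 - 2 * s) =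
  Csum (fun k => jacobi_coef a b n k * (s ^ k * (1 - s) ^ (n - k)))%C n.
Proof.
unfold jacobi; rewrite sum_n_Csum; apply Csum_ext; intros k Hk; unfold jacobi_coef.
replace ((1 - 2 * s - 1) / 2)%C with (-1 * s)%C by (field; apply Cneq_0_Re; simpl; lra).
replace ((1 - 2 * s + 1) / 2)%C with (1 - s)%C by (field; apply Cneq_0_Re; simpl; lra).
rewrite Cpow_mult_l; ring.
Qed.

(** Each binomial absorbs the lower part of a Pochhammer symbol: with (a)_k the first becomes (a)_n
    / (n - k)!, with (b)_(n-k) the second becomes (b)_n / k!. What remains is a summand of
    [fdiff]. *)
Lemma jacobi_coef_poch (a b : C) (n k l j : nat) : (k <= n)%nat ->
  (jacobi_coef a b n k * (poch a (k + l) * poch b (n - k + j)))%C =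
  (poch a n * poch b n * ((-1) ^ k / (INR (fact k) * INR (fact (n - k))) *
     (poch (a + INR k) l * poch (b + INR (n - k)) j)))%C.
Proof.
intros Hk; unfold jacobi_coef; rewrite !poch_add.
pose proof (Cbinom_poch a n (n - k) ltac:(lia)) as E1.
pose proof (Cbinom_poch b n k Hk) as E2.
replace (n - (n - k))%nat with k in E1 by lia.
transitivity ((Cbinom (INR n + (a - 1)) (n - k) * poch a k) *
  (Cbinom (INR n + (b - 1)) k * poch b (n - k)) *
  ((-1) ^ k * (poch (a + INR k) l * poch (b + INR (n - k)) j)))%C; [ring|].
rewrite E1, E2; field; split; apply INR_fact_C_neq_0.
Qed.

Lemma jacobi_coef_sum (a b : C) (m n l : nat) : (l <= m <= n)%nat ->
  Csum (fun k => jacobi_coef a b n k * (poch a (k + l) * poch b (n - k + (m - l))))%C n =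
  (poch a n * poch b n * (if Nat.eq_dec m n then (-1) ^ l else 0))%C.
Proof.
intros H; rewrite <- (fdiff_poch a b n m l H); unfold fdiff; rewrite <- Csum_mult_l.
apply Csum_ext; intros k Hk; now apply jacobi_coef_poch.
Qed.

Lemma jacobi_integral (a b : C) (m n : nat) : (m <= n)%nat -> 0 < Re a -> 0 < Re b ->
  Gamma (a + b + INR (m + n)) <> 0 ->
  is_RInt_gen (V := C_R_NormedModule)
    (fun s => jacobi (a - 1) (b - 1) m (1 - 2 * s) * jacobi (a - 1) (b - 1) n (1 - 2 * s)
       * (Cpower s (a - 1) * Cpower (1 - s)%R (b - 1)))%C
    (at_right 0) (at_left 1)
    (if Nat.eq_dec m n then
       Gamma (a + INR n) * Gamma (b + INR n) / Gamma (a + b + INR (n + n))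
       * Cbinom (INR n + INR n + (a - 1) + (b - 1)) n
     else RtoC 0)%C.
Proof.
intros Hmn Ha Hb HD.
set (D := (Gamma a * Gamma b / Gamma (a + b + INR (m + n)))%C).
replace (if Nat.eq_dec m n then _ else _)%C with
  (Csum (fun l => Csum (fun k => jacobi_coef a b m l * jacobi_coef a b n k *
     beta (a + INR (k + l)) (b + INR (n - k + (m - l))))%C n) m).
2:{ transitivity (Csum (fun l => (poch a n * poch b n * D) *
      (jacobi_coef a b m l * (if Nat.eq_dec m n then (-1) ^ l else 0)))%C m).
  - apply Csum_ext; intros l Hl.
    transitivity (jacobi_coef a b m l * D *
      Csum (fun k => jacobi_coef a b n k * (poch a (k + l) * poch b (n - k + (m - l)))) n)%C.
    + rewrite <- Csum_mult_l; apply Csum_ext; intros k Hk.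
      rewrite beta_poch; trivial;
        replace (k + l + (n - k + (m - l)))%nat with (m + n)%nat by lia; trivial.
      unfold D; ring.
    + rewrite jacobi_coef_sum by lia; ring.
  - rewrite Csum_mult_l; destruct (Nat.eq_dec m n) as [->|_].
    + rewrite (Gamma_poch a), (Gamma_poch b) by (lra || now apply Cneq_0_Re).
      replace (INR n + INR n + (a - 1) + (b - 1))%C with
        ((INR n + (a - 1)) + (INR n + (b - 1)))%C by ring.
      rewrite <- Cbinom_Vandermonde.
      (* The sign (-1)^l from the finite difference cancels the one in [jacobi_coef], which leaves
         the Vandermonde sum. *)
      replace (Csum (fun l => jacobi_coef a b n l * (-1) ^ l)%C n) with
        (Csum (fun l => Cbinom (INR n + (a - 1)) (n - l) * Cbinom (INR n + (b - 1)) l)%C n).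
      * unfold D; field; trivial.
      * apply Csum_ext; intros l _; unfold jacobi_coef.
        transitivity (Cbinom (INR n + (a - 1)) (n - l) * Cbinom (INR n + (b - 1)) l *
          ((-1) * (-1)) ^ l)%C; [|rewrite Cpow_mult_l; ring].
        replace (-1 * -1)%C with (RtoC 1) by (rewrite <- RtoC_mult; f_equal; ring).
        rewrite Cpow_1_l; ring.
    + rewrite (Csum_ext _ (fun l => 0 * 0)%C) by (intros; ring).
      rewrite Csum_mult_l; ring. }
apply (is_RInt_gen_ext_on (V := C_R_NormedModule) _ _ _
  (fun s => Csum (fun l => Csum (fun k => (jacobi_coef a b m l * jacobi_coef a b n k) *
    (Cpower s (a + INR (k + l) - 1) * Cpower (1 - s)%R (b + INR (n - k + (m - l)) - 1)))%C n) m)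
  _ _ spans_0_1).
- intros s Hs; rewrite !jacobi_jacobi_coef, Csum_mult, Cmult_comm, <- Csum_mult_l.
  apply Csum_ext; intros l Hl; rewrite <- Csum_mult_l; apply Csum_ext; intros k Hk.
  replace (a + INR (k + l) - 1)%C with ((a - 1) + INR (k + l))%C by ring.
  replace (b + INR (n - k + (m - l)) - 1)%C with ((b - 1) + INR (n - k + (m - l)))%C by ring.
  rewrite !(Cpower_plus), !Cpower_INR, !Cpow_add_r, RtoC_minus by lra; ring.
- apply (is_RInt_gen_Csum _ _ (fun l s =>
    Csum (fun k => (jacobi_coef a b m l * jacobi_coef a b n k) *
    (Cpower s (a + INR (k + l) - 1) * Cpower (1 - s)%R (b + INR (n - k + (m - l)) - 1)))%C n)).
  intros l Hl.
  apply (is_RInt_gen_Csum _ _ (fun k s => (jacobi_coef a b m l * jacobi_coef a b n k) *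
    (Cpower s (a + INR (k + l) - 1) * Cpower (1 - s)%R (b + INR (n - k + (m - l)) - 1)))%C).
  intros k Hk.
  apply is_RInt_gen_Cmult; try typeclasses eauto.
  apply is_RInt_gen_beta_0_1; now apply Re_INR_plus.
Qed.

(** * The segment from -i to i in real coordinates *)

Lemma segment_point (s : R) : (- Ci + s * (Ci - - Ci))%C = (Ci * RtoC (2 * s - 1))%C.
Proof. apply injective_projections; simpl; ring. Qed.

Lemma Ci_mul_Ci (z : C) : (Ci * (Ci * z))%C = (- z)%C.
Proof. destruct z; apply injective_projections; simpl; ring. Qed.

Lemma weight_on_axis (g d t : R) : -1 < t < 1 ->
  romanovski_weight g d (Ci * t) =
  (Cpower (1 + t)%R (g + Ci * d) * Cpower (1 - t)%R (g - Ci * d))%C.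
Proof.
intros Ht; unfold romanovski_weight; rewrite Ci_mul_Ci, RtoC_plus, RtoC_minus.
f_equal; f_equal; ring.
Qed.

(** For x = i t the bases 1 + t and 1 - t are positive, so their logarithms add; 2 d arctan (i t) =
    i d (ln (1 + t) - ln (1 - t)) supplies the imaginary exponents. *)
Lemma weight_arctan (g d t : R) : -1 < t < 1 ->
  romanovski_weight g d (Ci * t) =
  (Cpower ((Ci * t) ^ 2 + 1) g * Cexp (2 * d * Catan (Ci * t)))%C.
Proof.
intros Ht; rewrite weight_on_axis by easy.
unfold Catan; rewrite Ci_mul_Ci.
replace (1 + - RtoC t)%C with (RtoC (1 - t)) by (rewrite RtoC_minus; ring).
replace (1 - - RtoC t)%C with (RtoC (1 + t)) by (rewrite RtoC_plus; ring).
replace ((Ci * RtoC t) ^ 2 + 1)%C with (RtoC ((1 + t) * (1 - t)))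
  by (apply injective_projections; simpl; ring).
rewrite Cpower_mult_base by lra.
rewrite !Clog_pos, !Cpower_pos, <- !Cexp_plus by lra; f_equal.
assert (HCi : Ci <> 0) by (intros E; apply (f_equal Im) in E; simpl in E; lra).
replace (2 * d * ((RtoC (ln (1 - t)) - RtoC (ln (1 + t))) / (2 * Ci)))%C with
  (Ci * d * (RtoC (ln (1 + t)) - RtoC (ln (1 - t))))%C; [ring|].
replace (RtoC (ln (1 - t)) - RtoC (ln (1 + t)))%C with
  (Ci * (Ci * (RtoC (ln (1 + t)) - RtoC (ln (1 - t)))))%C by (rewrite Ci_mul_Ci; ring).
field; trivial.
Qed.

(* Unlike the formula of the theorem, this one has no exceptional case
   2 n + 2 g + 1 = 0. *)
Definition romanovski_pairing (g d : R) (m n : nat) : C :=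
  (if Nat.eq_dec m n then
     Ci * (-1) ^ n * Rpower 2 (2 * g + 1) *
     (Gamma (INR n + 1 + g + Ci * d) * Gamma (INR n + 1 + g - Ci * d)
      / Gamma (2 * INR n + 2 + 2 * g) * Cbinom (2 * INR n + 2 * g) n)
   else 0)%C.

Lemma romanovski_integral (g d : R) (m n : nat) : -1 < g ->
  is_segment_integral
    (fun x => romanovski g d m x * romanovski g d n x * romanovski_weight g d x)%C
    (- Ci) Ci (romanovski_pairing g d m n).
Proof.
intros Hg.
(* The integrand is symmetric in m and n and the values off the diagonal vanish, so m <= n may be
   assumed. *)
assert (Hle : forall m n, (m <= n)%nat -> is_segment_integral
    (fun x => romanovski g d m x * romanovski g d n x * romanovski_weight g d x)%C
    (- Ci) Ci (romanovski_pairing g d m n)).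
2:{ destruct (Nat.le_ge_cases m n) as [h|h]; [auto|].
  destruct (Nat.eq_dec m n) as [<-|Hmn]; [now apply Hle|].
  specialize (Hle n m h); unfold romanovski_pairing in *.
  destruct (Nat.eq_dec n m) as [Hnm|_]; [now symmetry in Hnm|].
  destruct (Nat.eq_dec m n) as [Hnm|_]; [contradiction|].
  revert Hle; unfold is_segment_integral.
  apply (is_RInt_gen_ext_on (V := C_R_NormedModule) _ _ _ _ _ _ spans_0_1).
  intros s _; refine (_ : @eq C _ _); ring. }
clear m n; intros m n Hmn; unfold is_segment_integral.
set (a := (g + 1 + Ci * d)%C); set (b := (g + 1 - Ci * d)%C).
assert (Hab : forall k, (a + b + INR k)%C = RtoC (2 * g + 2 + INR k)).
{ intros k; unfold a, b; rewrite !RtoC_plus, RtoC_mult.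
  rewrite RtoC_2; ring. }
assert (Ha : 0 < Re a) by (unfold a; simpl; lra).
assert (Hb : 0 < Re b) by (unfold b; simpl; lra).
assert (HG : forall k, Gamma (a + b + INR k) <> 0).
{ intros k; rewrite Hab; apply Gamma_neq_0; pose proof (pos_INR k); lra. }
(* The constants of x = i (2 s - 1): the normalization of the two polynomials, the power 2^(2g) from
   the bases 2 s and 2 (1 - s) of the weight, and dx = 2 i ds. *)
set (K := ((- Ci) ^ m * (- Ci) ^ n * Rpower 2 (2 * g) * (2 * Ci))%C).
pose proof (is_RInt_gen_Cmult _ _ K _ _ (jacobi_integral a b m n Hmn Ha Hb (HG _))) as H.
match type of H with is_RInt_gen _ _ _ ?l =>
  replace (romanovski_pairing g d m n) with (l : C); [revert H|] end.
- apply (is_RInt_gen_ext_on (V := C_R_NormedModule) _ _ _ _ _ _ spans_0_1).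
  intros s Hs; refine (_ : @eq C _ _).
  rewrite segment_point, weight_on_axis by lra.
  unfold romanovski; rewrite Ci_mul_Ci.
  replace (- RtoC (2 * s - 1))%C with (1 - 2 * RtoC s)%C
    by (rewrite RtoC_minus, RtoC_mult; ring).
  replace (1 + (2 * s - 1)) with (2 * s) by ring.
  replace (1 - (2 * s - 1)) with (2 * (1 - s)) by ring.
  rewrite !Cpower_mult_base by lra.
  replace (a - 1)%C with (g + Ci * d)%C by (unfold a; ring).
  replace (b - 1)%C with (g - Ci * d)%C by (unfold b; ring).
  assert (E2 : RtoC (Rpower 2 (2 * g)) = (Cpower 2 (g + Ci * d) * Cpower 2 (g - Ci * d))%C).
  { rewrite <- Cpower_plus, <- Cpower_R by lra; f_equal; rewrite RtoC_mult.
    rewrite RtoC_2; ring. }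
  unfold K; rewrite E2.
  replace (Ci - - Ci)%C with (2 * Ci)%C
    by (rewrite RtoC_2; ring).
  ring.
- unfold romanovski_pairing, K; refine (_ : @eq C _ _).
  destruct (Nat.eq_dec m n) as [->|_]; [|ring].
  rewrite Rpower_plus, Rpower_1, RtoC_mult by lra.
  replace ((- Ci) ^ n * (- Ci) ^ n)%C with ((-1) ^ n)%C.
  2:{ rewrite <- Cpow_mult_l; f_equal; apply injective_projections; simpl; ring. }
  replace (a + INR n)%C with (INR n + 1 + g + Ci * d)%C by (unfold a; ring).
  replace (b + INR n)%C with (INR n + 1 + g - Ci * d)%C by (unfold b; ring).
  rewrite Hab.
  replace (RtoC (2 * g + 2 + INR (n + n))) with (2 * INR n + 2 + 2 * g)%C
    by (rewrite plus_INR, <- !RtoC_mult, <- !RtoC_plus; f_equal; ring).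
  replace (INR n + INR n + (a - 1) + (b - 1))%C with (2 * INR n + 2 * g)%C
    by (rewrite RtoC_2;
        unfold a, b; ring).
  ring.
Qed.

(* The integral of R_m R_n w dx has the factor i (-1)^n: already
   R_0 = 1 and (for g = d = 0) R_1 = x, and along the segment from -i to i
   the integrals of dx and x^2 dx are 2 i and - 2 i / 3.

   The factor 1 / ((2n + 2g + 1) Gamma(n + 1 + 2g)) has a removable singularity
   at n = 0, g = -1/2, the only case in which 2n + 2g + 1 = 0; its value there
   is 1 / Gamma(n + 2 + 2g). *)
Theorem mainTheorem12 (g d : R) (Hg : -1 < g) :
  orthogonal_on_segment (romanovski g d) (romanovski_weight g d) (- Ci) Ci
  /\ (forall t : R, -1 < t < 1 ->
        let x := (Ci * t)%C in
        romanovski_weight g d x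
        = (Cpower (x ^ 2 + 1) g * Cexp (2 * d * Catan x))%C)
  /\ (forall m n : nat,
        let integral_is := is_segment_integral
          (fun x => romanovski g d m x * romanovski g d n x
                    * Cpower (x ^ 2 + 1) g * Cexp (2 * d * Catan x))%C
          (- Ci) Ci in
        (2 * INR n + 2 * g + 1 <> 0 ->
         integral_is
           (Ci * (-1) ^ n
            * (Rpower 2 (2 * g + 1) / (2 * INR n + 2 * g + 1)
               * (Gamma (INR n + 1 + g + Ci * d) * Gamma (INR n + 1 + g - Ci * d)
                  / (Gamma (INR n + 1 + 2 * g) * Gamma (INR n + 1)))
               * kronecker m n))%C)
        /\
        (2 * INR n + 2 * g + 1 = 0 ->
         integral_is
           (Ci * (-1) ^ n
            * (Rpower 2 (2 * g + 1)
               * (Gamma (INR n + 1 + g + Ci * d) * Gamma (INR n + 1 + g - Ci * d)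
                  / (Gamma (INR n + 2 + 2 * g) * Gamma (INR n + 1)))
               * kronecker m n))%C)).
Proof.
split; [|split].
- intros m n Hmn; pose proof (romanovski_integral g d m n Hg) as H.
  unfold romanovski_pairing in H; destruct (Nat.eq_dec m n); [contradiction | exact H].
- intros t Ht; now apply weight_arctan.
- intros m n integral_is.
  assert (H : integral_is (romanovski_pairing g d m n)).
  { generalize (romanovski_integral g d m n Hg); unfold integral_is, is_segment_integral.
    apply (is_RInt_gen_ext_on (V := C_R_NormedModule) _ _ _ _ _ _ spans_0_1).
    intros s Hs; refine (_ : @eq C _ _).
    rewrite segment_point, weight_arctan by lra; ring. }
  unfold romanovski_pairing in H.
  split; intros Hn; (evar_last; [exact H|]); refine (_ : @eq C _ _); unfold kronecker;
    (destruct (Nat.eq_dec m n) as [->|_]; [|ring]).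
  (* Since z + n = 2 n + 2 g + 1, Gamma (2 n + 2 + 2 g) = (z)_n (z + n) Gamma z. The numerator of
     the binomial is (z)_n too, and it cancels. *)
  + set (z := (INR n + 1 + 2 * g)%C).
    assert (Hz : -1 < Re z) by (unfold z; pose proof (pos_INR n); simpl; lra).
    (* As 2 g > -2, z = 0 would force n = 0 and g = -1/2, the excluded case. *)
    assert (Hz0 : z <> 0).
    { unfold z; rewrite <- RtoC_mult, <- !RtoC_plus; intros E; apply RtoC_inj in E.
      destruct n; [simpl in *; lra|]; rewrite S_INR in *; pose proof (pos_INR n); lra. }
    pose proof (Gamma_poch z (S n) Hz Hz0) as E.
    pose proof (falling_poch z n n (le_n n)) as F.
    rewrite Nat.sub_diag in F; unfold poch at 1 in F; simpl (Cprod _ 0) in F.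
    rewrite Gamma_INR_S; unfold Cbinom.
    replace (INR n + (z - 1))%C with (2 * INR n + 2 * g)%C in F.
    2:{ unfold z; rewrite RtoC_2; ring. }
    rewrite Cmult_1_r in F; rewrite F.
    unfold poch at 1 in E; simpl Cprod in E; fold (poch z n) in E.
    assert (Hz1 : (z + INR n)%C = (2 * INR n + 2 * g + 1)%C).
    { unfold z; rewrite RtoC_2; ring. }
    replace (z + INR (S n))%C with (2 * INR n + 2 + 2 * g)%C in E.
    2:{ rewrite INR_C_S, Cplus_assoc, Hz1.
      rewrite RtoC_2; ring. }
    rewrite Hz1 in E.
    (* Gamma is nonzero at the positive real 2 n + 2 + 2 g, so each factor is nonzero; this covers
       Gamma z even when z is negative. *)
    assert (HE : (poch z n * (2 * INR n + 2 * g + 1) * Gamma z)%C <> 0).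
    { rewrite <- E, <- !RtoC_mult, <- !RtoC_plus; apply Gamma_neq_0.
      pose proof (pos_INR n); lra. }
    rewrite E.
    pose proof (INR_fact_C_neq_0 n).
    field; repeat split; trivial; intros E0; apply HE; rewrite E0; ring.
  (* From g > -1 only n = 0 is possible; the binomial is then the empty product 1. *)
  + assert (Hn0 : n = 0%nat).
    { destruct n; trivial; rewrite S_INR in Hn; pose proof (pos_INR n); lra. }
    subst n; rewrite Gamma_INR_S; unfold Cbinom; simpl INR; simpl Cprod.
    replace (2 * 0 + 2 + 2 * g)%C with (0 + 2 + 2 * g)%C by ring.
    assert (HG : Gamma (0 + 2 + 2 * g) <> 0).
    { rewrite <- !RtoC_mult, <- !RtoC_plus; apply Gamma_neq_0; lra. }
    simpl; field; trivial.
Qed.
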